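(* Let $(\Omega,\mathcal F,\mathbb P,(\mathcal F_t)_{t\ge 0})$ be a filtered probability space satisfying the usual conditions. Let $X=(X_t)_{t\ge0}$ and $G=(G_t)_{t\ge0}$ be non-negative, adapted, right-continuous processes ($X$ need not be non-decreasing), and let $G$ be in addition non-decreasing and predictable, such that $\mathbb E[X_\sigma\mid\mathcal F_0]\le\mathbb E[G_\sigma\mid\mathcal F_0]\le\infty$ for every bounded stopping time $\sigma$. Then for every $p\in(0,1)$ and every stopping time $\tau$, $$\mathbb E[X_\tau^p]\le p^{-p}\,\mathbb E[G_\tau^p].$$
   Context: All processes are real-valued. Usual conditions: the filtration is right-continuous and $\mathcal F_0$ contains all $\mathbb P$-null sets of the completed $\sigma$-algebra $\mathcal F$. Predictable means measurable with respect to the $\sigma$-algebra on $[0,\infty)\times\Omega$ generated by the left-continuous adapted processes. Conditional expectations of non-negative random variables take values in $[0,\infty]$. If $\tau$ takes the value $\infty$, then on $\{\tau=\infty\}$ the conventions are $X_\tau:=0$ and $G_\tau:=\sup_{t\ge0}G_t$. *)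

(* Defs.v *)
From HB Require Import structures.
From mathcomp Require Import all_boot all_order all_algebra.
From mathcomp Require Import all_classical all_reals all_analysis.
From mathcomp Require Import measurable_realfun.

Set Implicit Arguments.
Unset Strict Implicit.
Unset Printing Implicit Defensive.

Import Order.TTheory GRing.Theory Num.Theory.
Import numFieldNormedType.Exports.

Local Open Scope classical_set_scope.
Local Open Scope ring_scope.

(* Time is [0, oo), represented by the t : R with 0 <= t: the values at negative
   times of a filtration [set (set T) at each time] or of a process are
   unconstrained and never used. *)

Section sub_sigma_algebra.
Context {d : measure_display} {T : measurableType d} {R : realType}.
Implicit Types (P : probability T R) (A : set (set T)).

(* For a sigma-algebra A, the measurable sets of g_sigma_algebraType A are
   exactly the members of A. *)
Definition measurable_wrt A {d' : measure_display} {U : measurableType d'}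
    (Y : T -> U) : Prop :=
  measurable_fun [set: g_sigma_algebraType A] (Y : g_sigma_algebraType A -> U).

Definition is_cond_exp P A (Y Z : T -> \bar R) : Prop :=
  [/\ measurable_wrt A Z,
      (forall w, 0 <= Z w)%E &
      forall B, A B -> (\int[P]_(w in B) Z w = \int[P]_(w in B) Y w)%E].

(* E[Y | A] for a non-negative random variable Y, with values in [0, +oo]: some
   version, chosen classically. By cond_expP below there is one as soon as Y is
   measurable and A is a sub-sigma-algebra; versions agree P-almost surely. *)
Definition cond_exp P A (Y : T -> \bar R) : T -> \bar R :=
  xget (cst 0%E) [set Z | is_cond_exp P A Y Z].

End sub_sigma_algebra.

Section cond_exp_exists.
Context {d : measure_display} {T : measurableType d} {R : realType}.
Local Open Scope ereal_scope.
Variables (P : probability T R) (A : set (set T)).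
Hypotheses (sA : sigma_algebra setT A) (AT : A `<=` measurable).

Let T' : measurableType _ := g_sigma_algebraType A.

Let mA (B : set T) : measurable (B : set T') = A B.
Proof. by have := measurable_g_measurableTypeE sA; move=> ->. Qed.

Let mid : measurable_fun setT (idfun : T -> T').
Proof. by move=> _ B; rewrite mA setTI => /AT. Qed.

Lemma cond_exp_exists_fin (Y : T -> \bar R) : measurable_fun setT Y ->
  (forall w, 0 <= Y w) -> \int[P]_w Y w < +oo -> exists Z, is_cond_exp P A Y Z.
Proof.
move=> mY Y0 iY.
pose nu : set T' -> \bar R := fun B => \int[P]_(w in B) Y w.
have nu0 : nu set0 = 0 by rewrite /nu integral_set0.
have nu_ge0 B : 0 <= nu B by exact: integral_ge0.
have nu_sadd : semi_sigma_additive nu.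
  move=> B mB tB mUB; apply: semi_sigma_additive_nng_induced => //.
  - by move=> i; apply: AT; rewrite -mA.
  - by apply: AT; rewrite -mA.
have nu_fin : fin_num_fun nu.
  move=> B; rewrite mA => /AT mB; rewrite ge0_fin_numE//.
  apply: le_lt_trans iY; exact: ge0_subset_integral.
pose mu : set T' -> \bar R := pushforward P (idfun : T -> T').
have mu0 : mu set0 = 0 by exact: measure0.
have mu_ge0 B : 0 <= mu B by exact: measure_ge0.
have mu_sadd : semi_sigma_additive mu.
  move=> B mB tB mUB; apply: (@measure_semi_sigma_additive _ T R P) => //.
  - by move=> i; apply: AT; move: (mB i); rewrite mA.
  - by apply: (AT (t := \bigcup_n B n)); rewrite -mA.
have mu_fin : fin_num_fun mu.
  by move=> B; rewrite mA => /AT mB; exact: fin_num_measure.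
pose nuM := isMeasure.Build _ _ _ nu nu0 nu_ge0 nu_sadd.
pose nu1 : {measure set T' -> \bar R} := HB.pack nu nuM.
pose nuF := Measure_isFinite.Build _ _ _ nu1 nu_fin.
pose nu2 : {finite_measure set T' -> \bar R} := HB.pack (Measure.sort nu1) nuF.
pose muM := isMeasure.Build _ _ _ mu mu0 mu_ge0 mu_sadd.
pose mu1 : {measure set T' -> \bar R} := HB.pack mu muM.
pose muF := Measure_isFinite.Build _ _ _ mu1 mu_fin.
pose mu2 : {finite_measure set T' -> \bar R} := HB.pack (Measure.sort mu1) muF.
have [|Z [Z0 iZ ZE]] := @radon_nikodym_finite _ T' R mu2 nu2.
  apply/null_content_dominatesP => B; rewrite mA => /AT mB B0.
  by apply: null_set_integral => //; exact: measurable_funTS.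
exists Z; have mZ : measurable_wrt A Z by exact: measurable_int iZ.
split => // B AB; rewrite -[RHS]/(nu2 B) ZE ?mA//.
have := @ge0_integral_pushforward _ _ _ _ _ _ mid P B Z.
rewrite mA => /(_ AB) -> //; exact: measurable_funTS.
Qed.

Lemma cond_exp_exists (Y : T -> \bar R) : measurable_fun setT Y ->
  (forall w, 0 <= Y w) -> exists Z, is_cond_exp P A Y Z.
Proof.
move=> mY Y0.
pose M n w := mine (Y w) n%:R%:E.
have M0 n w : 0 <= M n w by rewrite le_min Y0 lee_fin ler0n.
have Mfin n w : M n w \is a fin_num.
  by rewrite ge0_fin_numE// gt_min ltry orbT.
have MS n w : M n w <= M n.+1 w.
  by rewrite le_min ge_min lexx/= ge_min lee_fin ler_nat leqnSn orbT.
have mM n : measurable_fun setT (M n).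
  by apply: measurable_mine => //; exact: measurable_cst.
pose D n w := M n.+1 w - M n w.
have D0 n w : 0 <= D n w by rewrite sube_ge0// Mfin.
have mD n : measurable_fun setT (D n) by exact: emeasurable_funB.
have DE w : \sum_(n <oo) D n w = Y w.
  apply/cvg_lim => //.
  have -> : (fun n => \sum_(0 <= i < n) D i w) = fun n => M n w.
    apply/funext => n; rewrite telescope_sume//.
    by rewrite /M (min_idPr (Y0 w)) sube0.
  move: (Y0 w); rewrite /M; case: (Y w) => [r r0| _|//].
    apply: cvg_near_cst; near=> n; apply/min_idPl; rewrite lee_fin.
    by near: n; exact: nbhs_infty_ger.
  under eq_fun do rewrite (min_idPr (leey _)).
  exact/cvgenyP.
have Dint n : \int[P]_w D n w < +oo.
  apply: (@le_lt_trans _ _ (\int[P]_w (cst n.+1%:R%:E) w)).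
    apply: ge0_le_integral => //.
    move=> w _; apply: (@le_trans _ _ (M n.+1 w)); last by rewrite ge_min lexx orbT.
    by rewrite leeBlDr// leeDl.
  by rewrite integral_cst//= probability_setT mule1 ltry.
have /choice[Z ZP] n := cond_exp_exists_fin (mD n) (D0 n) (Dint n).
exists (fun w => \sum_(n <oo) Z n w); split.
- apply: (@ge0_emeasurable_sum _ T' R setT Z xpredT) => // n *; by case: (ZP n).
- by move=> w; apply: nneseries_ge0 => n _ _; case: (ZP n).
- move=> B AB; have mB := AT AB.
  rewrite integral_nneseries//; last 2 first.
  + move=> n; apply: measurable_funTS.
    by case: (ZP n) => mZ _ _; exact: (measurableT_comp mZ mid).
  + by move=> n w _; case: (ZP n).
  under eq_integral do rewrite -DE.
  rewrite integral_nneseries//; last by move=> n; exact: measurable_funTS.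
  by apply: eq_eseriesr => n _; case: (ZP n) => _ _ ->.
Unshelve. all: by end_near. Qed.

Lemma cond_expP (Y : T -> \bar R) : measurable_fun setT Y ->
  (forall w, 0 <= Y w) -> is_cond_exp P A Y (cond_exp P A Y).
Proof.
by move=> mY Y0; have := cond_exp_exists mY Y0; exact: xgetPex.
Qed.

End cond_exp_exists.

Section processes.
Context {d : measure_display} {T : measurableType d} {R : realType}.
Implicit Types (P : probability T R) (F : R -> set (set T)) (X H : R -> T -> R)
  (tau : T -> \bar R).

Definition is_filtration F : Prop :=
  [/\ forall t, 0 <= t -> sigma_algebra [set: T] (F t),
      forall t, 0 <= t -> F t `<=` measurable &
      forall s t, 0 <= s -> s <= t -> F s `<=` F t].

(* As F 0 consists of measurable sets, the last condition also says that the
   sigma-algebra of T is complete for P. *)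
Definition usual_conditions P F : Prop :=
  [/\ is_filtration F,
      forall t, 0 <= t -> F t = \bigcap_(s in [set s | t < s]) F s &
      forall N, P.-negligible N -> F 0 N].

Definition adapted F X : Prop := forall t, 0 <= t -> measurable_wrt (F t) (X t).

Definition right_continuous_process X : Prop :=
  forall w t, 0 <= t -> X s w @[s --> t^'+] --> X t w.

Definition left_continuous_process X : Prop :=
  forall w t, 0 < t -> X s w @[s --> t^'-] --> X t w.

Definition process_preimage X (B : set R) : set (R * T) :=
  [set x | 0 <= x.1 /\ B (X x.1 x.2)].

(* A sigma-algebra on [0, oo) x T, hence generated inside [set x | 0 <= x.1];
   left-continuity of the generating processes is vacuous at time 0. *)
Definition predictable_sets F : set (set (R * T)) :=
  <<s [set x : R * T | 0 <= x.1],
      [set S | exists (H : R -> T -> R) (B : set R),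
         [/\ adapted F H, left_continuous_process H, measurable B &
             S = process_preimage H B]] >>.

Definition predictable F X : Prop :=
  forall B : set R, measurable B -> predictable_sets F (process_preimage X B).

Definition nonneg_process X : Prop := forall t w, 0 <= t -> 0 <= X t w.

Definition nondecreasing_process X : Prop :=
  forall s t w, 0 <= s -> s <= t -> X s w <= X t w.

Definition stopping_time F tau : Prop :=
  (forall w, 0 <= tau w)%E /\
  (forall t, 0 <= t -> F t [set w | (tau w <= t%:E)%E]).

Definition bounded_time tau : Prop := exists c : R, forall w, (tau w <= c%:E)%E.

(* X_tau, with the value Xoo on {tau = +oo}. *)
Definition stopped X (Xoo : T -> \bar R) tau (w : T) : \bar R :=
  if tau w is t%:E then (X t w)%:E else Xoo w.

Definition sup_process X (w : T) : \bar R :=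
  ereal_sup [set (X t w)%:E | t in [set t : R | 0 <= t]].

End processes.

(* Main.v *)
Require Import Defs.
From mathcomp Require Import all_boot all_order all_algebra.
From mathcomp Require Import all_classical all_reals all_analysis.
From mathcomp Require Import measurable_realfun ring lra.
Import Order.TTheory GRing.Theory Num.Theory.
Import numFieldNormedType.Exports.

(** Write [x = X_tau], [g = G_tau]. The first time [S] at which the predictable
    process [G] reaches a level [l] is announced by stopping times [sigma_n < S];
    the domination hypothesis at [sigma_n], restricted to [G_0 < l], and Fatou
    give [E[x; g < l] <= E[min(g, l)]]. With [M = max(g, e)], integrating this
    against [l^(p-2) dl] over [l >= e] gives [E[x M^(p-1)] <= E[M^p] / p]. The
    tangent line of [y^p] at [y = 1/p] gives
    [x^p <= p^(-p) (p^2 x M^(p-1) + (1 - p) M^p)], whence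
    [E[x^p] <= p^(-p) E[M^p]]; then [e] tends to [0].

    The announcing sequence is obtained without a section theorem. Call a set of
    [[0, oo) x Omega] a zero set if it is [{H = 0}] for an adapted [H] which is
    1-Lipschitz in time. Sets which, together with their complement, are
    approximable from inside by zero sets along the graph of [S] (up to small
    probability) form a sigma-algebra, which contains the predictable sets. A zero
    set [{H = 0}] inside [{G >= l}] carrying almost all of the graph of [S] is
    announced by the times at which [H] gets below a small threshold, and
    Borel-Cantelli combines such [H_k] into the [sigma_n]. *)

Set Implicit Arguments.
Unset Strict Implicit.
Unset Printing Implicit Defensive.

(** * Moments from truncated expectations *)

Section power_weights.
Context {R : realType}.
Local Open Scope classical_set_scope.
Local Open Scope ring_scope.
Implicit Types (p x M e : R).

(** In the variable [z = p x / M] this is Bernoulli's inequality [z^p <= p z + (1 - p)], multiplied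
    by [p^(-p) M^p]. The point of tangency [z = 1] is [x = M / p], which is where the constant
    [p^(-p)] comes from. *)
Lemma powR_le_tangent p x M : 0 < p < 1 -> 0 <= x -> 0 < M ->
  x `^ p <= p `^ (- p) * (p ^+ 2 * (x * M `^ (p - 1)) + (1 - p) * M `^ p).
Proof.
move=> /andP[p0 p1] x0 M0.
set z := p * x / M.
have z0 : 0 <= z by rewrite /z divr_ge0 ?mulr_ge0// ltW.
(* Young's inequality for the product of [z^p] and [1], with conjugate exponents [1/p] and
   [1/(1 - p)]. *)
have bern : z `^ p <= p * z + (1 - p).
  have := @conjugate_powR R (z `^ p) 1 p^-1 (1 - p)^-1 (powR_ge0 _ _) ler01.
  rewrite !invr_gt0 !invrK subr_gt0 => /(_ p0 p1).
  rewrite -powRrM mulfV ?gt_eqF// powRr1// powR1 mulr1 mul1r [z * p]mulrC.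
  by apply; rewrite addrC subrK.
have -> : x = z * M * p^-1.
  by rewrite /z; field; rewrite ?gt_eqF.
have pV0 : 0 <= p^-1 by rewrite invr_ge0 ltW.
have M0' := ltW M0.
rewrite [X in X <= _](powRM _ (mulr_ge0 z0 M0') pV0) (powRM _ z0 M0').
have -> : p^-1 `^ p = p `^ (- p).
  by rewrite -powR_inv1 ?ltW// -powRrM mulN1r.
rewrite [X in X <= _]mulrC ler_wpM2l ?powR_ge0//.
rewrite powRB ?(gt_eqF M0) ?implybT// powRr1//.
apply: (@le_trans _ _ ((p * z + (1 - p)) * M `^ p)).
  by rewrite ler_wpM2r// powR_ge0.
rewrite le_eqVlt; apply/orP; left; apply/eqP; field.
by rewrite !gt_eqF.
Qed.

Local Notation mu := (@lebesgue_measure R).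

Lemma is_derive_powR_div (q x : R) : q != 0 -> 0 < x ->
  is_derive x 1 (fun y => y `^ q / q) (x `^ (q - 1)).
Proof.
move=> q0 x0.
have := @is_derive1_powR R q x x0 => H.
have -> : (fun y => y `^ q / q) = q^-1 \*: (fun y => y `^ q).
  by apply/funext => y /=; rewrite mulrC.
have -> : x `^ (q - 1) = q^-1 *: (q * x `^ (q - 1)).
  by rewrite /GRing.scale/= mulrA mulVf// mul1r.
exact: is_deriveZ.
Qed.

Lemma continuous_powR_gt0 (q x : R) : 0 < x -> {for x, continuous (fun y => y `^ q)}.
Proof.
move=> x0; apply: differentiable_continuous; apply/derivable1_diffP.
by apply: derivable_powR; rewrite in_itv/= andbT.
Qed.

Lemma powR_neg_cvg0 (q : R) : q < 0 -> x `^ q @[x --> +oo] --> (0 : R).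
Proof.
move=> q0; apply/cvgrPdist_lt => e e0.
near=> x; have x0 : 0 < x by near: x; exact: nbhs_pinfty_gt.
rewrite sub0r normrN ger0_norm ?powR_ge0//.
have : (e `^ q^-1) < x by near: x; apply: nbhs_pinfty_gt; rewrite num_real.
move=> h.
have -> : e = (e `^ q^-1) `^ q by rewrite -powRrM mulVf ?lt_eqF// powRr1 ?ltW.
rewrite -ltf_pV2 ?posrE ?powR_gt0// -!powRN.
by rewrite gt0_ltr_powR ?oppr_gt0// ?in_itv/= ?nnegrE ?ltW// powR_gt0.
Unshelve. all: by end_near. Qed.

Lemma integral_powR_tail p M : p < 1 -> 0 < M ->
  (\int[mu]_(x in `[M, +oo[) (x `^ (p - 2))%:E = (M `^ (p - 1) / (1 - p))%:E)%E.
Proof.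
move=> p1 M0.
have p10 : p - 1 < 0 by rewrite subr_lt0.
have p2E : p - 2 = p - 1 - 1 by ring.
rewrite (@ge0_continuous_FTC2y _ _ (fun x => x `^ (p - 1) / (p - 1)) M 0).
- by rewrite -EFinB sub0r -mulrN -invrN opprB.
- by move=> x _; exact: powR_ge0.
- apply: continuous_in_subspaceT => x; rewrite inE/= in_itv/= andbT => Mx.
  by apply: continuous_powR_gt0; exact: lt_le_trans Mx.
- rewrite -[X in _ --> X](mul0r (p - 1)^-1); apply: cvgM; last exact: cvg_cst.
  exact: powR_neg_cvg0.
- move=> x Mx; have x0 := lt_trans M0 Mx.
  by have [] := @is_derive_powR_div (p - 1) x (ltr0_neq0 p10) x0.
- apply: cvg_at_right_filter; apply: cvgM; last exact: cvg_cst.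
  exact: continuous_powR_gt0.
- move=> x; rewrite in_itv/= andbT => Mx; have x0 := lt_trans M0 Mx.
  rewrite derive1E p2E.
  by have [_ ->] := @is_derive_powR_div (p - 1) x (ltr0_neq0 p10) x0.
Qed.

(** The exact value is [(M^p - e^p) / p], and the subtracted term is dropped. The cutoff [e] keeps
    the integrand away from its singularity at [0]. *)
Lemma integral_powR_head p e M : 0 < p -> 0 < e -> e <= M ->
  (\int[mu]_(x in `[e, M]) (x `^ (p - 1))%:E <= (M `^ p / p)%:E)%E.
Proof.
move=> p0 e0; rewrite le_eqVlt => /predU1P[->|eM].
  by rewrite set_itv1 integral_set1 lee_fin divr_ge0 ?powR_ge0 ?ltW.
rewrite (@continuous_FTC2 _ _ (fun x => x `^ p / p))//.
- by rewrite -EFinB lee_fin gerBl divr_ge0 ?powR_ge0// ltW.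
- apply: continuous_in_subspaceT => x; rewrite inE/= in_itv/= => /andP[ex _].
  by apply: continuous_powR_gt0; exact: lt_le_trans ex.
- split.
  + move=> x; rewrite in_itv/= => /andP[ex _].
    by have [] := @is_derive_powR_div p x (lt0r_neq0 p0) (lt_trans e0 ex).
  + apply: cvg_at_right_filter; apply: cvgM; last exact: cvg_cst.
    exact: continuous_powR_gt0.
  + apply: cvg_at_left_filter; apply: cvgM; last exact: cvg_cst.
    apply: continuous_powR_gt0; exact: lt_trans eM.
- move=> x; rewrite in_itv/= => /andP[ex _].
  rewrite derive1E.
  by have [_ ->] := @is_derive_powR_div p x (lt0r_neq0 p0) (lt_trans e0 ex).
Qed.

End power_weights.

(** * Integrals of the level weight [l^(p-2)] *)

Section moments.
Context {d : measure_display} {T : measurableType d} {R : realType}.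
Local Open Scope classical_set_scope.
Local Open Scope ring_scope.
Local Open Scope ereal_scope.
Local Notation mu := (@lebesgue_measure R).

(** The range of [l] is split at [M = max(g, e)]. Below [M] the minimum is at most [l], above it at
    most [M]; the two pieces give [M^p / p] and [M^p / (1 - p)]. *)
Lemma integral_min_powR_le (g p e : R) : (0 < p < 1)%R -> (0 < e)%R ->
  (0 <= g)%R ->
  \int[mu]_(l in `[e, +oo[) ((l `^ (p - 2))%:E * mine g%:E l%:E)
  <= ((Num.max g e `^ p) / (p * (1 - p)))%:E.
Proof.
move=> /andP[p0 p1] e0 g0; set M := Num.max g e.
have eM : (e <= M)%R by rewrite le_max lexx orbT.
have M0 : (0 < M)%R by exact: lt_le_trans eM.
have mpow q : measurable_fun setT (fun l : R => (l `^ q)%:E).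
  by apply/measurable_EFinP; exact: measurable_powR.
have mf : measurable_fun setT (fun l : R => (l `^ (p - 2))%:E * mine g%:E l%:E).
  apply: emeasurable_funM => //; apply: measurable_mine; first exact: measurable_cst.
  by apply/measurable_EFinP.
have f0 l : (e <= l)%R -> 0 <= (l `^ (p - 2))%:E * mine g%:E l%:E.
  move=> el; rewrite mule_ge0 ?lee_fin ?powR_ge0// le_min !lee_fin g0/=.
  by rewrite (le_trans (ltW e0)).
have -> : `[e, +oo[%classic = `[e, M]%classic `|` `]M, +oo[%classic :> set R.
  by rewrite (@itv_bndbnd_setU _ _ _ (BRight M))// bnd_simp.
rewrite ge0_integral_setU//=; last 3 first.
- exact: measurable_funTS.
- move=> l [/=|/=]; rewrite in_itv/= ?andbT; first by move=> /andP[el _]; exact: f0.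
  by move=> Ml; apply: f0; rewrite (le_trans eM)// ltW.
- rewrite disj_set2E; apply/eqP; rewrite -subset0 => l /=.
  by rewrite !in_itv/= andbT => -[/andP[_ +] Ml]; rewrite leNgt Ml.
have -> : (M `^ p / (p * (1 - p)))%:E = (M `^ p / p)%:E + (M `^ p / (1 - p))%:E.
  rewrite -EFinD; congr EFin; field.
  by rewrite (gt_eqF p0) subr_eq0 gt_eqF.
apply: leeD.
  apply: le_trans (integral_powR_head p0 e0 eM).
  apply: ge0_le_integral => //=.
  - by move=> l; rewrite in_itv/= => /andP[el _]; exact: f0.
  - exact: measurable_funTS.
  - by apply: measurable_funTS; exact: mpow.
  - move=> l; rewrite in_itv/= => /andP[el _].
    have l0 : (0 < l)%R by exact: lt_le_trans el.
    have -> : (p - 1 = p - 2 + 1)%R by ring.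
    rewrite (@powRD _ l (p - 2) 1) ?(gt_eqF l0) ?implybT// powRr1 ?(ltW l0)// EFinM.
    by rewrite lee_wpmul2l ?lee_fin ?powR_ge0// ge_min lexx orbT.
have -> : (M `^ p / (1 - p))%:E = M%:E * (M `^ (p - 1) / (1 - p))%:E.
  by rewrite -EFinM mulrA mulr_powRB1// ltW.
rewrite -integral_powR_tail// -ge0_integralZl//; last 3 first.
- by apply: measurable_funTS; exact: mpow.
- by move=> l _; rewrite lee_fin powR_ge0.
- by rewrite lee_fin ltW.
- rewrite -integral_itv_obnd_cbnd; last first.
    by apply: emeasurable_funM => //; exact: measurable_funTS.
  apply: ge0_le_integral => //=.
  - move=> l; rewrite in_itv/= andbT => Ml.
    by apply: f0; rewrite (le_trans eM)// ltW.
  - exact: measurable_funTS.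
  - by apply: emeasurable_funM => //; apply: measurable_funTS; exact: mpow.
  - move=> l _; rewrite muleC lee_wpmul2r ?lee_fin ?powR_ge0//.
    by rewrite ge_min lee_fin le_max lexx.
Qed.

(** The levels [l > max(g, e)] belong to the domain of integration, and the weight integrates there
    to [max(g, e)^(p-1) / (1 - p)]. This turns the event [g < l] into a power of [max(g, e)]. *)
Lemma integral_tail_powR_ge (g x p e : R) : (0 < p < 1)%R -> (0 < e)%R ->
  (0 <= x)%R ->
  (x * (Num.max g e `^ (p - 1) / (1 - p)))%:E <=
  \int[mu]_(l in `[e, +oo[ `&` [set l | g%:E < l%:E]) (x * l `^ (p - 2))%:E.
Proof.
move=> /andP[p0 p1] e0 x0; set M := Num.max g e.
have eM : (e <= M)%R by rewrite le_max lexx orbT.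
have M0 : (0 < M)%R by exact: lt_le_trans eM.
have mpow q : measurable_fun setT (fun l : R => (l `^ q)%:E).
  by apply/measurable_EFinP; exact: measurable_powR.
have mf : measurable_fun setT (fun l : R => (x * l `^ (p - 2))%:E).
  apply/measurable_EFinP; apply: measurable_funM => //.
rewrite EFinM -integral_powR_tail// -ge0_integralZl//; last 2 first.
- by apply: measurable_funTS; exact: mpow.
- by move=> l _; rewrite lee_fin powR_ge0.
- rewrite -integral_itv_obnd_cbnd; last exact: measurable_funTS.
  apply: ge0_subset_integral => //.
  + apply: measurableI => //.
    rewrite (_ : [set _ | _] = `]g, +oo[%classic)//.
    by apply/seteqP; split => l /=; rewrite in_itv/= andbT lte_fin.
  + exact: measurable_funTS.
  + by move=> l _; rewrite lee_fin mulr_ge0// powR_ge0.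
  + move=> l /=; rewrite !in_itv/= !andbT lte_fin gt_max => /andP[-> el].
    by rewrite ltW.
Qed.

End moments.

(** * Integration of the truncated inequality over the level *)

Section moments.
Context {d : measure_display} {T : measurableType d} {R : realType}.
Local Open Scope classical_set_scope.
Local Open Scope ring_scope.
Local Open Scope ereal_scope.
Local Notation mu := (@lebesgue_measure R).
Variables (P : probability T R) (x : T -> R) (g : T -> \bar R) (p : R).
Hypotheses (p01 : (0 < p < 1)%R)
  (mx : measurable_fun setT x) (x0 : forall w, (0 <= x w)%R)
  (mg : measurable_fun setT g) (g0 : forall w, 0 <= g w)
  (gx : forall w, g w = +oo -> x w = 0%R)
  (xg : forall l : R, (0 < l)%R ->
     \int[P]_(w in [set w | g w < l%:E]) (x w)%:E <= \int[P]_w mine (g w) l%:E).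

(** [f1] and [f2] are the integrands of the two sides of [xg], weighted by [l^(p-2)] and restricted
    to [l >= e]. They live on the product space so that Tonelli's theorem can exchange the outcome
    and the level. *)
Let f1 (e : R) : T * R -> \bar R := (fun z => (x z.1 * z.2 `^ (p - 2))%:E)
  \_ [set z | (e <= z.2)%R /\ g z.1 < z.2%:E].
Let f2 (e : R) : T * R -> \bar R := (fun z => (z.2 `^ (p - 2))%:E * mine (g z.1) z.2%:E)
  \_ [set z | (e <= z.2)%R].

Let mpow2 : measurable_fun setT (fun z : T * R => (z.2 `^ (p - 2))%R).
Proof. by apply: (measurableT_comp (measurable_powR _)). Qed.

Let mA e : measurable [set z : T * R | (e <= z.2)%R].
Proof.
rewrite (_ : [set _ | _] = setT `*` `[e, +oo[%classic); first exact: measurableX.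
by apply/seteqP; split => z /=; rewrite in_itv/= andbT // => -[].
Qed.

Let mf1 e : measurable_fun setT (f1 e).
Proof.
have mD : measurable [set z : T * R | (e <= z.2)%R /\ g z.1 < z.2%:E].
  apply: (@measurableI _ _ [set z | (e <= z.2)%R] [set z | g z.1 < z.2%:E]) => //.
  rewrite -[X in measurable X]setTI; apply: measurable_lte => //.
    exact: measurableT_comp.
  exact/measurable_EFinP.
apply/(measurable_restrictT _ mD).
apply: measurable_funTS; apply/measurable_EFinP/measurable_funM => //.
exact: measurableT_comp.
Qed.

Let mf2 e : measurable_fun setT (f2 e).
Proof.
apply/(measurable_restrictT _ (mA e)).
apply: measurable_funTS; apply: emeasurable_funM; first exact/measurable_EFinP.
apply: measurable_mine; first exact: measurableT_comp.
exact/measurable_EFinP.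
Qed.

Let f1_ge0 e z : 0 <= f1 e z.
Proof.
by apply: erestrict_ge0 => y _; rewrite lee_fin mulr_ge0// powR_ge0.
Qed.

Let f2_ge0 e z : (0 < e)%R -> 0 <= f2 e z.
Proof.
move=> e0; apply: erestrict_ge0 => y /= ey.
rewrite mule_ge0 ?lee_fin ?powR_ge0// le_min g0 lee_fin.
by rewrite (le_trans (ltW e0)).
Qed.

Let f1f2 e l : (0 < e)%R -> \int[P]_w f1 e (w, l) <= \int[P]_w f2 e (w, l).
Proof.
move=> e0; have [el|le] := leP e l; last first.
  rewrite [leLHS](_ : _ = 0); first by apply: integral_ge0 => w _; exact: f2_ge0.
  apply: integral0_eq => w _.
  by rewrite /f1 patchE ifF//; apply/negbTE; rewrite notin_setE/= leNgt le => -[].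
have l0 : (0 < l)%R by exact: lt_le_trans el.
have mgl : measurable [set w | g w < l%:E].
  by rewrite -[X in measurable X]setTI; exact: emeasurable_fun_infty_o.
have -> : \int[P]_w f1 e (w, l) =
    (l `^ (p - 2))%:E * \int[P]_(w in [set w | g w < l%:E]) (x w)%:E.
  rewrite -ge0_integralZl ?lee_fin ?powR_ge0//; last 2 first.
  - by apply: measurable_funTS; exact/measurable_EFinP.
  - by move=> w _; rewrite lee_fin.
  rewrite [RHS]integral_mkcond; apply: eq_integral => w _.
  rewrite /f1 !patchE; case: ifPn; rewrite ?inE ?notin_setE/=.
    by move=> [_ gl]; rewrite mem_set//= -EFinM mulrC.
  by move=> h; rewrite memNset//= => gl; exact: h.
have -> : \int[P]_w f2 e (w, l) =
    (l `^ (p - 2))%:E * \int[P]_w mine (g w) l%:E.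
  rewrite -ge0_integralZl ?lee_fin ?powR_ge0//; last 2 first.
  - by apply: measurable_mine => //; exact: measurable_cst.
  - by move=> w _; rewrite le_min g0 lee_fin ltW.
  by apply: eq_integral => w _; rewrite /f2 patchE mem_set.
by rewrite lee_wpmul2l ?lee_fin ?powR_ge0// xg.
Qed.

(** The tangent inequality at [M = max(g, e)], where [x M^(p-1)] is bounded by [1 - p] times the
    level integral of [f1]. Where [g] is infinite, [gx] makes the left side vanish. *)
Let pointwise e w : (0 < e)%R ->
  (x w)%:E `^ p <= (p `^ (- p))%:E * ((p ^+ 2 * (1 - p))%:E * \int[mu]_l f1 e (w, l)
    + (1 - p)%:E * maxe (g w) e%:E `^ p).
Proof.
move=> e0; have /andP[p0 p1] := p01.
have I0 : 0 <= \int[mu]_l f1 e (w, l) by apply: integral_ge0.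
have c0 : (0 <= p ^+ 2 * (1 - p))%R by rewrite mulr_ge0 ?sqr_ge0// subr_ge0 ltW.
have [gy|gfin] := eqVneq (g w) +oo.
  rewrite gx// poweR0r ?gt_eqF// mule_ge0 ?lee_fin ?powR_ge0//.
  by rewrite adde_ge0// mule_ge0// ?poweR_ge0// lee_fin ?subr_ge0 ?ltW.
have gE : g w = (fine (g w))%:E by rewrite fineK// ge0_fin_numE// lt_neqAle gfin leey.
have := @integral_tail_powR_ge _ (fine (g w)) (x w) p e p01 e0 (x0 w).
rewrite -gE.
have -> : \int[mu]_(l in `[e, +oo[ `&` [set l | g w < l%:E]) (x w * l `^ (p - 2))%:E
    = \int[mu]_l f1 e (w, l).
  rewrite integral_mkcond; apply: eq_integral => l _.
  rewrite /f1 !patchE; congr (if _ then _ else _).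
  by apply/idP/idP; rewrite !inE/= in_itv/= andbT.
move=> hI.
rewrite gE; have -> : maxe (fine (g w))%:E e%:E = (Num.max (fine (g w)) e)%:E.
  by rewrite EFin_max.
set M := Num.max _ _.
have M0 : (0 < M)%R by rewrite lt_max e0 orbT.
have := powR_le_tangent p01 (x0 w) M0; rewrite -lee_fin => h.
rewrite !poweR_EFin; apply: le_trans h _.
rewrite EFinM lee_wpmul2l ?lee_fin ?powR_ge0// EFinD.
apply: leeD; last by rewrite EFinM.
apply: le_trans (lee_wpmul2l _ hI); last by rewrite lee_fin.
rewrite -EFinM lee_fin le_eqVlt; apply/orP; left; apply/eqP; field.
by rewrite subr_eq0 gt_eqF.
Qed.

Let integral_f2 e w : (0 < e)%R ->
  \int[mu]_l f2 e (w, l) <= ((p * (1 - p))^-1)%:E * maxe (g w) e%:E `^ p.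
Proof.
move=> e0; have /andP[p0 p1] := p01.
have c0 : (0 < (p * (1 - p))^-1)%R by rewrite invr_gt0 mulr_gt0 ?subr_gt0.
have [gy|gfin] := eqVneq (g w) +oo.
  by rewrite gy max_l ?leey// poweRyr ?gt_eqF// gt0_muley ?leey//.
have gE : g w = (fine (g w))%:E by rewrite fineK// ge0_fin_numE// lt_neqAle gfin leey.
have g0' : (0 <= fine (g w))%R by rewrite fine_ge0.
have := @integral_min_powR_le _ (fine (g w)) p e p01 e0 g0'.
rewrite -gE.
have -> : \int[mu]_(l in `[e, +oo[) ((l `^ (p - 2))%:E * mine (g w) l%:E)
   = \int[mu]_l f2 e (w, l).
  rewrite integral_mkcond; apply: eq_integral => l _.
  rewrite /f2 !patchE; congr (if _ then _ else _).
  by apply/idP/idP; rewrite !inE/= in_itv/= andbT.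
move=> /le_trans; apply.
rewrite gE; have -> : maxe (fine (g w))%:E e%:E = (Num.max (fine (g w)) e)%:E.
  by rewrite EFin_max.
by rewrite poweR_EFin -EFinM mulrC.
Qed.

(** [pointwise] is integrated over the outcomes; Tonelli's theorem then allows [f1f2] to be applied
    level by level and [integral_f2] outcome by outcome. *)
Let moment_le_max e : (0 < e)%R ->
  \int[P]_w ((x w)%:E `^ p) <=
  (p `^ (- p))%:E * \int[P]_w (maxe (g w) e%:E `^ p).
Proof.
move=> e0; have /andP[p0 p1] := p01.
have q0 : (0 < 1 - p)%R by rewrite subr_gt0.
have c0 : (0 <= p ^+ 2 * (1 - p))%R by rewrite mulr_ge0 ?sqr_ge0// ltW.
have f20 z : 0 <= f2 e z by exact: f2_ge0.
have mM : measurable_fun setT (fun w => maxe (g w) e%:E `^ p).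
  apply: (measurableT_comp (measurable_poweR _)).
  by apply: measurable_maxe => //; exact: measurable_cst.
have mI : measurable_fun setT (fun w => \int[mu]_l f1 e (w, l)).
  exact: (@measurable_fun_fubini_tonelli_F _ _ _ _ _ mu (f1 e) (mf1 e) (f1_ge0 e)).
have I0 w : 0 <= \int[mu]_l f1 e (w, l) by apply: integral_ge0.
apply: le_trans.
  apply: ge0_le_integral => //; last by move=> w _; exact: (pointwise w e0).
  - by move=> w _; exact: poweR_ge0.
  - apply: (measurableT_comp (measurable_poweR _)); exact/measurable_EFinP.
  - apply: emeasurable_funM; first exact: measurable_cst.
    apply: emeasurable_funD; apply: emeasurable_funM => //; exact: measurable_cst.
rewrite ge0_integralZl ?lee_fin ?powR_ge0//; last 2 first.
- apply: emeasurable_funD; apply: emeasurable_funM => //; exact: measurable_cst.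
- by move=> w _; rewrite adde_ge0// mule_ge0 ?poweR_ge0// lee_fin// ltW.
rewrite lee_wpmul2l ?lee_fin ?powR_ge0//.
rewrite ge0_integralD//; last 4 first.
- by move=> w _; rewrite mule_ge0.
- by apply: emeasurable_funM => //; exact: measurable_cst.
- by move=> w _; rewrite mule_ge0 ?poweR_ge0// lee_fin ltW.
- by apply: emeasurable_funM => //; exact: measurable_cst.
rewrite !ge0_integralZl//; last 2 first.
- by move=> w _; exact: poweR_ge0.
- by rewrite lee_fin ltW.
set IM := \int[P]_w _ `^ p.
have IM0 : 0 <= IM by apply: integral_ge0 => w _; exact: poweR_ge0.
(* The share [1 - p] is already present on the left; the [f1] term has to fit into the share [p],
   and it does because [p^2 (1 - p) / (p (1 - p)) = p]. *)
have IMD : IM = p%:E * IM + (1 - p)%:E * IM.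
  by rewrite -ge0_muleDl ?lee_fin ?ltW// -EFinD addrC subrK mul1e.
rewrite [leRHS]IMD; apply: leeD => //.
have fub f : measurable_fun setT f -> (forall z, 0 <= f z) ->
    \int[P]_w \int[mu]_l f (w, l) = \int[mu]_l \int[P]_w f (w, l).
  exact: fubini_tonelli.
rewrite (fub _ (mf1 e) (f1_ge0 e)).
apply: (@le_trans _ _ ((p ^+ 2 * (1 - p))%:E * (((p * (1 - p))^-1)%:E * IM))).
  rewrite lee_wpmul2l ?lee_fin//.
  apply: (@le_trans _ _ (\int[mu]_l \int[P]_w f2 e (w, l))).
    apply: ge0_le_integral => //.
    - by move=> l _; apply: integral_ge0.
    - exact: (@measurable_fun_fubini_tonelli_G _ _ _ _ _ P (f1 e) (mf1 e) (f1_ge0 e)).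
    - exact: (@measurable_fun_fubini_tonelli_G _ _ _ _ _ P (f2 e) (mf2 e) f20).
    - by move=> l _; exact: f1f2.
  rewrite -(fub _ (mf2 e) f20).
  rewrite /IM -ge0_integralZl//; last 2 first.
  - by move=> w _; exact: poweR_ge0.
  - by rewrite lee_fin invr_ge0 mulr_ge0// ltW.
  apply: ge0_le_integral => //.
  - by move=> w _; apply: integral_ge0 => l _; exact: f2_ge0.
  - exact: (@measurable_fun_fubini_tonelli_F _ _ _ _ _ mu (f2 e) (mf2 e) f20).
  - by apply: emeasurable_funM => //; exact: measurable_cst.
  - by move=> w _; exact: integral_f2.
rewrite muleA -EFinM le_eqVlt; apply/orP; left; apply/eqP; congr (_%:E * _); field.
by rewrite !gt_eqF.
Qed.

Lemma moment_le_of_truncated :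
  \int[P]_w ((x w)%:E `^ p) <= (p `^ (- p))%:E * \int[P]_w (g w `^ p).
Proof.
have /andP[p0 p1] := p01.
have mgp : measurable_fun setT (fun w => g w `^ p).
  exact: (measurableT_comp (measurable_poweR _)).
have pp0 : (0 < p `^ (- p))%R by rewrite powR_gt0.
apply/lee_addgt0Pr => e e0.
(* The cutoff [r] is chosen with [p^(-p) r^p = e], so that [max(g, r)^p <= g^p + r^p] costs exactly
   the allowed error [e]. *)
pose c := (e / (p `^ (- p)))%R; have c0 : (0 < c)%R by rewrite divr_gt0.
pose r := (c `^ (p^-1))%R; have r0 : (0 < r)%R by rewrite powR_gt0.
have rp : (r `^ p = c)%R by rewrite /r -powRrM mulVf ?gt_eqF// powRr1// ltW.
apply: le_trans (moment_le_max r0) _.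
have -> : e%:E = (p `^ (- p))%:E * c%:E.
  by rewrite -EFinM; congr EFin; rewrite /c; field; rewrite gt_eqF.
rewrite -ge0_muleDr ?lee_fin ?(ltW c0)//; last by apply: integral_ge0 => w _; exact: poweR_ge0.
rewrite lee_wpmul2l ?lee_fin ?powR_ge0//.
have -> : c%:E = \int[P]_w (cst c%:E w).
  by rewrite integral_cst//= probability_setT mule1.
rewrite -ge0_integralD//; last 2 first.
- by move=> w _; exact: poweR_ge0.
- by move=> w _ /=; rewrite lee_fin ltW.
apply: ge0_le_integral => //.
- by move=> w _; exact: poweR_ge0.
- apply: (measurableT_comp (measurable_poweR _)).
  by apply: measurable_maxe => //; exact: measurable_cst.
- by apply: emeasurable_funD => //; exact: measurable_cst.
- move=> w _ /=; have [gr|gr] := leP (g w) r%:E.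
    by rewrite poweR_EFin rp leeDr// poweR_ge0.
  by rewrite leeDl// lee_fin ltW.
Qed.

End moments.

(** * Inner regularity of predictable sets *)

Section random_time.
Context {d : measure_display} {T : measurableType d} {R : realType}.
Local Open Scope classical_set_scope.
Local Open Scope ring_scope.
Implicit Types (X H : R -> T -> R) (S : T -> R) (A : set (set T)).

Lemma measurable_wrtP {d' : measure_display} {U : measurableType d'} A
    (Y : T -> U) : sigma_algebra setT A ->
  measurable_wrt A Y <-> forall B, measurable B -> A (Y @^-1` B).
Proof.
move=> sA; have mA (B : set (g_sigma_algebraType A)) : measurable B = A B.
  by have := measurable_g_measurableTypeE sA => ->.
split=> [mY B mB|h _ B mB]; last by rewrite setTI mA; exact: h.
by have := mY measurableT B mB; rewrite setTI mA.
Qed.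

Lemma measurable_wrt_le {d' : measure_display} {U : measurableType d'} A
    (Y : T -> U) : sigma_algebra setT A ->
  A `<=` measurable -> measurable_wrt A Y -> measurable_fun setT Y.
Proof.
by move=> sA AT /(measurable_wrtP _ sA) h _ B mB; rewrite setTI; exact/AT/h.
Qed.

(** Continuity from above of a finite measure. It serves to stop countable unions at a finite stage
    and to choose thresholds. *)
Lemma exists_measure_le (P : probability T R) (V : nat -> set T) (e : R) :
  (forall n, measurable (V n)) -> nonincreasing_seq V ->
  \bigcap_n V n = set0 -> 0 < e -> exists n, (P (V n) <= e%:E)%E.
Proof.
move=> mV dV V0 e0.
have : P \o V @ \oo --> P (\bigcap_n V n).
  apply: nonincreasing_cvg_mu => //; last by rewrite V0.
  by rewrite (le_lt_trans (probability_le1 _ _))// ltry.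
rewrite V0 measure0 => /fine_cvgP[_ /cvgrPdist_le/(_ _ e0)[n _ /(_ n (leqnn _))]].
rewrite sub0r normrN ger0_norm ?fine_ge0// => Vn; exists n.
by rewrite -[P (V n)]fineK ?lee_fin// fin_num_measure.
Qed.

Lemma cvg_dist_harmonic (u : R^nat) (x : R) :
  (forall n, `|u n - x| <= n.+1%:R^-1) -> u @ \oo --> x.
Proof.
move=> h; apply/cvgrPdist_le => e e0.
near=> n; rewrite distrC (le_trans (h n))// ltW//.
by near: n; exact: (near_infty_natSinv_lt (PosNum e0)).
Unshelve. all: by end_near. Qed.

(** [S] is approximated from the right by times with values in a grid. At such times the process is
    measurable piece by piece, and right-continuity gives the limit. *)
Lemma measurable_right_continuous_at X S : right_continuous_process X ->
  (forall t, 0 <= t -> measurable_fun setT (X t)) ->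
  measurable_fun setT S -> (forall w, 0 <= S w) ->
  measurable_fun setT (fun w => X (S w) w).
Proof.
move=> rX mX mS S0.
(* The successor puts the grid point strictly after [s], as the punctured filter [s^'+] requires. *)
pose q n (s : R) : R := (Num.truncn (s * n.+1%:R)).+1%:R / n.+1%:R.
have qS n s : s < q n s by rewrite /q ltr_pdivlMr// truncnS_gt.
have qlim s : 0 <= s -> q ^~ s @ \oo --> s.
  move=> s0; apply: cvg_dist_harmonic => n.
  rewrite gtr0_norm ?subr_gt0// lerBlDr -[X in _ <= X + _]mul1r.
  rewrite /q ler_pdivrMr// mulrDl -mulrA mulVf ?gt_eqF// mulr1.
  rewrite -addn1 natrD addrC lerD2l.
  by have /andP[] := @truncn_itv _ (s * n.+1%:R) (mulr_ge0 s0 (ler0n _ _)).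
apply: (@measurable_fun_cvg _ _ _ setT (fun n w => X (q n (S w)) w)); last first.
  move=> w _; have /cvg_at_rightP := @rX w (S w) (S0 w).
  by apply; split => [n|]; [exact: qS|exact: qlim].
move=> n.
have mSn : measurable_fun setT (fun w => S w * n.+1%:R) by exact: measurable_funM.
pose E k := [set w | Num.truncn (S w * n.+1%:R) = k].
have mE k : measurable (E k).
  have -> : E k = (fun w => S w * n.+1%:R) @^-1` `[k%:R, k.+1%:R[.
    apply/seteqP; split => w; rewrite /E/= in_itv/= -truncn_eq ?mulr_ge0//.
      by move=> ->.
    by move/eqP.
  rewrite -[X in measurable X]setTI.
  exact: mSn.
have -> : setT = \bigcup_k E k.
  by apply/seteqP; split => w //= _; exists (Num.truncn (S w * n.+1%:R)).
apply/measurable_fun_bigcup => // k.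
apply: (@eq_measurable_fun _ _ _ _ _ (X (k.+1%:R / n.+1%:R))).
  by move=> w; rewrite inE /E/= /q => ->.
by apply: measurable_funTS; apply: mX; rewrite divr_ge0.
Qed.

End random_time.

(** * Adapted processes that are 1-Lipschitz in time *)

Section lipschitz_adapted.
Context {d : measure_display} {T : measurableType d} {R : realType}.
Local Open Scope classical_set_scope.
Local Open Scope ring_scope.
Variable F : R -> set (set T).
Hypothesis hF : is_filtration F.
Implicit Types (H : R -> T -> R).

(** The common bound and the common Lipschitz constant make the class stable under countable
    suprema. *)
Definition lipschitz_adapted H : Prop :=
  [/\ forall t w, 0 <= H t w <= 1,
      forall s t w, `|H s w - H t w| <= `|s - t| &
      adapted F H].

Lemma lipschitz_adapted_right_continuous H : lipschitz_adapted H ->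
  right_continuous_process H.
Proof.
move=> [_ lH _] w t _; apply/cvg_at_rightP => u [_ ut].
apply/cvgrPdist_le => e e0; near=> n.
rewrite distrC (le_trans (lH _ _ _))// distrC.
by near: n; move/cvgrPdist_le : ut; exact.
Unshelve. all: by end_near. Qed.

(** For non-negative processes the minimum vanishes on the union of the two zero sets. *)
Lemma lipschitz_adapted_min H K : lipschitz_adapted H -> lipschitz_adapted K ->
  lipschitz_adapted (fun t w => Num.min (H t w) (K t w)).
Proof.
move=> [H01 lH aH] [K01 lK aK]; split.
- move=> t w; have /andP[h0 h1] := H01 t w; have /andP[k0 k1] := K01 t w.
  by rewrite le_min h0 k0 ge_min h1.
- move=> s t w; have := lH s t w; have := lK s t w.
  by rewrite !ler_norml; case: (leP (H s w)); case: (leP (H t w)); lra.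
- move=> t t0; apply: measurable_minr; [exact: aH|exact: aK].
Qed.

(** The zero set of a supremum is the intersection of the zero sets. [sups _ 0] is the supremum of
    the whole sequence. *)
Lemma lipschitz_adapted_sup (H : nat -> R -> T -> R) :
  (forall n, lipschitz_adapted (H n)) ->
  lipschitz_adapted (fun t w => sups (fun n => H n t w) 0).
Proof.
move=> hH.
have ub t w : has_ubound (range (fun n => H n t w)).
  exists 1 => _ [n _ <-]; by have [/(_ t w)/andP[]] := hH n.
have ub' t w : has_ubound (sdrop (fun n => H n t w) 0).
  exact/has_ubound_sdrop/ub.
have ge n t w : H n t w <= sups (fun n => H n t w) 0.
  by apply: ub_le_sup => //; exists n.
have le t w c : (forall n, H n t w <= c) -> sups (fun n => H n t w) 0 <= c.
  move=> h; apply: ge_sup; first by exists (H 0%N t w); exists 0%N.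
  by move=> _ [n _ <-].
split.
- move=> t w; apply/andP; split.
    by apply: le_trans (ge 0%N t w); have [/(_ t w)/andP[]] := hH 0%N.
  by apply: le => n; have [/(_ t w)/andP[]] := hH n.
- move=> s t w.
  have one a b : sups (fun n => H n a w) 0 <= sups (fun n => H n b w) 0 + `|a - b|.
    apply: le => n; have [_ /(_ a b w) + _] := hH n.
    by rewrite ler_norml => /andP[_]; have := ge n b w; lra.
  by rewrite ler_norml; have := one s t; have := one t s; rewrite [`|t - s|]distrC; lra.
- move=> t t0; apply: measurable_fun_sups => [w _|n]; first exact: ub.
  by have [_ _] := hH n; exact.
Qed.

Lemma lipschitz_adapted_sup_eq0 (H : nat -> R -> T -> R) t w :
  (forall n, lipschitz_adapted (H n)) ->
  sups (fun n => H n t w) 0 = 0 <-> forall n, H n t w = 0.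
Proof.
move=> hH; split => [h n|h]; last first.
  rewrite /sups /= (_ : sdrop _ _ = [set 0]) ?sup1//.
  by apply/seteqP; split => [_ [n _ <-]/=|_ ->]; [rewrite h|exists 0%N].
have /andP[h0 _] : 0 <= H n t w <= 1 by have [/(_ t w)] := hH n.
apply/eqP; rewrite eq_le h0 andbT -[leRHS]h; apply: ub_le_sup; last by exists n.
by apply/has_ubound_sdrop; exists 1 => _ [m _ <-]; have [/(_ t w)/andP[]] := hH m.
Qed.

(** The basic supply of zero sets: the process vanishes where [A] holds and [phi] reaches its
    ceiling [c], and, for [c > 0], nowhere else. The event [A] has to be known only at times when
    [phi] is non-zero. *)
Lemma lipschitz_adapted_indic (c : R) (phi : R -> R) (A : set T) :
  0 <= c <= 1 -> (forall t, 0 <= phi t <= c) ->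
  (forall s t, `|phi s - phi t| <= `|s - t|) ->
  (forall t, 0 <= t -> phi t = 0 \/ F t A) ->
  lipschitz_adapted (fun t w => c - \1_A w * phi t).
Proof.
move=> /andP[c0 c1] phi0c lphi FA; split.
- move=> t w; have := phi0c t; rewrite indicE; case: (w \in A) => /=; rewrite ?mul1r ?mul0r; lra.
- move=> s t w; rewrite indicE; case: (w \in A) => /=.
    by rewrite !mul1r opprD addrACA subrr add0r opprK addrC distrC.
  by rewrite !mul0r subrr normr0.
- move=> t t0; have [-> | FtA] := FA t t0.
    rewrite (_ : (fun _ => _) = cst c); first exact: measurable_cst.
    by apply/funext => w; rewrite mulr0 subr0.
  apply: measurable_funB; first exact: measurable_cst.
  apply: measurable_funM; last exact: measurable_cst.
  apply: measurable_indic; have [sF _ _] := hF.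
  by rewrite (measurable_g_measurableTypeE (sF t t0)).
Qed.

End lipschitz_adapted.

(** * Inner approximation along the graph of a random time *)

Section inner_regularity.
Context {d : measure_display} {T : measurableType d} {R : realType}.
Local Open Scope classical_set_scope.
Local Open Scope ring_scope.
Variables (P : probability T R) (F : R -> set (set T)) (S : T -> R).
Hypotheses (hF : is_filtration F) (mS : measurable_fun setT S)
  (S0 : forall w, 0 <= S w).
Implicit Types (H : R -> T -> R) (D : set (R * T)) (A : set T).

Definition graph_section D : set T := [set w | D (S w, w)].

Definition missed_section D H : set T :=
  graph_section D `&` [set w | H (S w) w != 0].

(** This is inner regularity of the image of [P] under [w -> (S w, w)], with the zero sets in the
    role of the closed sets. *)
Definition inner_approximable D : Prop := forall e : R, 0 < e ->
  exists H, [/\ lipschitz_adapted F H,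
    (forall t w, 0 <= t -> H t w = 0 -> D (t, w)) &
    (P (missed_section D H) <= e%:E)%E].

Lemma lipschitz_adapted_measurable H : lipschitz_adapted F H ->
  measurable_fun setT (fun w => H (S w) w).
Proof.
move=> hH; apply: measurable_right_continuous_at => //.
  exact: lipschitz_adapted_right_continuous hH.
move=> t t0; have [sF FT _] := hF; have [_ _ aH] := hH.
exact: measurable_wrt_le (sF _ t0) (FT _ t0) (aH _ t0).
Qed.

Lemma measurable_lipschitz_neq0 H : lipschitz_adapted F H ->
  measurable [set w | H (S w) w != 0].
Proof.
move=> hH; have mH := lipschitz_adapted_measurable hH.
rewrite (_ : [set _ | _] = (fun w => H (S w) w) @^-1` (~` [set 0])).
  by rewrite -[X in measurable X]setTI; apply: mH => //; exact: measurableC.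
by apply/seteqP; split => w /= /eqP.
Qed.

Lemma inner_approximable_zero H D : lipschitz_adapted F H ->
  (forall t w, 0 <= t -> D (t, w) <-> H t w = 0) -> inner_approximable D.
Proof.
move=> hH DE e e0; exists H; split => // [t w t0 h|]; first exact/DE.
rewrite (_ : missed_section _ _ = set0) ?measure0 ?lee_fin ?ltW//.
by rewrite -subset0 => w [/(DE _ _ (S0 w)) h] /=; rewrite h eqxx.
Qed.

Lemma inner_approximable_setU D E :
  measurable (graph_section D) -> measurable (graph_section E) ->
  inner_approximable D -> inner_approximable E -> inner_approximable (D `|` E).
Proof.
move=> mD mE iD iE e e0; have e20 : 0 < e / 2 by rewrite divr_gt0.
have [H [hH HD PH]] := iD _ e20; have [K [hK KE PK]] := iE _ e20.
exists (fun t w => Num.min (H t w) (K t w)).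
have hHK := lipschitz_adapted_min hH hK.
split => //.
  move=> t w t0; case: (leP (H t w) (K t w)) => _ h; first by left; exact: HD.
  by right; exact: KE.
have mA : measurable (missed_section D H).
  by apply: measurableI => //; exact: measurable_lipschitz_neq0.
have mB : measurable (missed_section E K).
  by apply: measurableI => //; exact: measurable_lipschitz_neq0.
apply: (@le_trans _ _ (P (missed_section D H `|` missed_section E K))).
  apply: le_measure; rewrite ?inE.
  - apply: measurableI; [exact: measurableU|exact: measurable_lipschitz_neq0 hHK].
  - exact: measurableU.
  - have [H01 _ _] := hH; have [K01 _ _] := hK.
    move=> w [/= DE h].
    have {}h : H (S w) w != 0 /\ K (S w) w != 0.
      split; apply: contra_neq h => h; rewrite h.
        by apply/min_idPl; have /andP[] := K01 (S w) w.
      by apply/min_idPr; have /andP[] := H01 (S w) w.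
    by case: DE => ?; [left|right]; split => //; case: h.
apply: (le_trans (measureU2 _ mA mB)).
by rewrite [e]splitr EFinD; exact: leeD.
Qed.

(** An infimum of infinitely many processes may vanish outside the union. So the union is cut at a
    finite stage, which loses [e / 2] by continuity from above, and the finite union is approximated
    up to [e / 2]. *)
Lemma inner_approximable_bigcup (D : nat -> set (R * T)) :
  (forall n, measurable (graph_section (D n))) ->
  (forall n, inner_approximable (D n)) -> inner_approximable (\bigcup_n D n).
Proof.
move=> mD iD e e0; have e20 : 0 < e / 2 by rewrite divr_gt0.
pose U n := \bigcup_(i < n) D i.
have mU n : measurable (graph_section (U n)).
  by apply: bigcup_measurable => k _; exact: mD.
have mDD : measurable (graph_section (\bigcup_n D n)).
  by apply: bigcup_measurable => k _; exact: mD.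
have iU n : inner_approximable (U n).
  rewrite /U; elim: n => [|n IH].
    rewrite bigcup_mkord big_ord0.
    (* The empty union is the zero set of the constant process [1]. *)
    apply: (@inner_approximable_zero (fun _ _ => 1)).
      split => [t w|s t w|t t0]; [by rewrite ler01 lexx|by rewrite subrr normr0|].
      exact: measurable_cst.
    by move=> t w _; split => // /eqP; rewrite oner_eq0.
  rewrite bigcup_mkord big_ord_recr/= -bigcup_mkord.
  exact: inner_approximable_setU (mU n) (mD n) IH (iD n).
pose V n := graph_section (\bigcup_n D n) `\` graph_section (U n).
have mV n : measurable (V n) by exact: measurableD.
have V0 : \bigcap_n V n = set0.
  rewrite -subset0 => w Vw; have [[k _ Dk] _] := Vw 0%N I.
  by have [_] := Vw k.+1 I; apply; exists k => /=.
have dV : nonincreasing_seq V.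
  move=> m n mn; apply/subsetPset => w [Dw nU]; split => // -[k /= km Dk].
  by apply: nU; exists k => //=; exact: leq_trans mn.
have [N VN] := exists_measure_le P mV dV V0 e20.
have [H [hH HU PH]] := iU N _ e20.
exists H; split => // [t w t0 /HU -/(_ t0)[k _ Dk]|]; first by exists k.
have mA : measurable (missed_section (U N) H).
  by apply: measurableI => //; exact: measurable_lipschitz_neq0.
apply: (@le_trans _ _ (P (V N `|` missed_section (U N) H))).
  apply: le_measure; rewrite ?inE.
  - by apply: measurableI => //; exact: measurable_lipschitz_neq0.
  - exact: measurableU.
  - move=> w [Dw Hw]; have [Uw|nUw] := pselect (graph_section (U N) w); first by right.
    by left.
apply: (le_trans (measureU2 _ (mV N) mA)).
by rewrite [e]splitr EFinD; exact: leeD.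
Qed.

(** The supremum of the approximating processes works, with errors [e / 2^(n+1)] that sum to [e]. *)
Lemma inner_approximable_bigcap (D : nat -> set (R * T)) :
  (forall n, measurable (graph_section (D n))) ->
  (forall n, inner_approximable (D n)) -> inner_approximable (\bigcap_n D n).
Proof.
move=> mD iD e e0.
have /choice[H hH] n : exists H, [/\ lipschitz_adapted F H,
    (forall t w, 0 <= t -> H t w = 0 -> D n (t, w)) &
    (P (missed_section (D n) H) <= (e / (2 ^ n.+1)%:R)%:E)%E].
  by apply: iD; rewrite divr_gt0// ltr0n expn_gt0.
have lH n : lipschitz_adapted F (H n) by have [] := hH n.
exists (fun t w => sups (fun n => H n t w) 0).
have lsup := lipschitz_adapted_sup lH.
split => // [t w t0 /(lipschitz_adapted_sup_eq0 _ _ lH) H0 n _|].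
  by have [_ + _] := hH n; apply.
have mN n : measurable (missed_section (D n) (H n)).
  by apply: measurableI => //; exact: measurable_lipschitz_neq0.
apply: le_trans (epsilon_trick0 xpredT (ltW e0)).
apply: (@le_trans _ _ (\sum_(n <oo) P (missed_section (D n) (H n)))%E); last first.
  by apply: lee_nneseries => // n *; have [_ _ h] := hH n; exact: h.
apply: measure_sigma_subadditive => //.
  apply: measurableI; last exact: measurable_lipschitz_neq0 lsup.
  by apply: bigcap_measurable => // k _; exact: mD.
move=> w [Dw /= /eqP Hw].
have /existsNP[n Hn] : ~ forall n, H n (S w) w = 0.
  by move/(lipschitz_adapted_sup_eq0 _ _ lH).
by exists n => //; split; [exact: Dw|exact/eqP].
Qed.

End inner_regularity.

Lemma clamp_lipschitz {R : realDomainType} (c s t : R) :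
  (`|Num.min c (Num.max 0 s) - Num.min c (Num.max 0 t)| <= `|s - t|)%R.
Proof.
rewrite ler_norml; have := ler_norm (s - t); have := ler_norm (t - s).
rewrite distrC.
case: (leP 0%R s) => ?; [case: (leP c s) => ?|case: (leP c 0%R) => ?];
  (case: (leP 0%R t) => ?; [case: (leP c t) => ?|case: (leP c 0%R) => ?]); lra.
Qed.

(** * The sigma-algebra of regular sets *)

Section predictable_regularity.
Context {d : measure_display} {T : measurableType d} {R : realType}.
Local Open Scope classical_set_scope.
Local Open Scope ring_scope.
Variables (P : probability T R) (F : R -> set (set T)) (S : T -> R).
Hypotheses (hF : is_filtration F) (mS : measurable_fun setT S)
  (S0 : forall w, 0 <= S w).
Implicit Types (H : R -> T -> R) (D : set (R * T)) (A : set T).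

Local Notation D0 := [set z : R * T | 0 <= z.1].
Local Notation inner := (inner_approximable P F S).

(** Approximability is required of the complement too, so that complementation preserves the class;
    countable unions then use the union lemma on one side and the intersection lemma on the
    other. *)
Definition regular_set D : Prop := [/\ D `<=` D0,
  measurable (graph_section S D), inner D & inner (D0 `\` D)].

Lemma measurable_graph_section_lt a A : 0 <= a -> F a A ->
  measurable (graph_section S [set z | a < z.1 /\ A z.2]).
Proof.
move=> a0 FA; have [_ FT _] := hF.
have := measurableI _ _ (mS measurableT (@measurable_itv _ `]a, +oo[)) (FT _ a0 _ FA).
rewrite setTI; congr (measurable _); apply/seteqP.
by split => w; rewrite /graph_section/= in_itv/= andbT.
Qed.

(** The set is the union over [n] of its parts from time [a + 1/(n+1)] on. With [c = 1/(n+1)], each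
    part is the zero set of [c] minus the indicator of [A] times the distance past [a] clamped to
    [[0, c]]. That ramp vanishes up to time [a], so [A] in [F a] is enough for adaptedness. *)
Lemma inner_approximable_lt a A : 0 <= a -> F a A ->
  inner [set z | a < z.1 /\ A z.2].
Proof.
move=> a0 FA.
have [_ _ FS] := hF.
pose E n := [set z : R * T | a + n.+1%:R^-1 <= z.1 /\ A z.2].
have -> : [set z | a < z.1 /\ A z.2] = \bigcup_n E n.
  apply/seteqP; split => [[t w] /= [at_ Aw]|[t w] [n _ [/= nt Aw]]].
    have ta : 0 < t - a by rewrite subr_gt0.
    have [n _ /(_ n (leqnn _)) hn] := near_infty_natSinv_lt (PosNum ta).
    exists n => //; split => //=.
    have {}hn : n.+1%:R^-1 < t - a := hn.
    by rewrite -lerBrDl ltW.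
  split => //=; apply: lt_le_trans nt; by rewrite ltrDl invr_gt0.
apply: inner_approximable_bigcup => // [n|n].
  have := measurable_graph_section_lt a0 FA.
  have [_ FT _] := hF.
  have := measurableI _ _ (mS measurableT (@measurable_itv _ `[a + n.+1%:R^-1, +oo[)) (FT _ a0 _ FA).
  rewrite setTI => + _; congr (measurable _); apply/seteqP.
  by split => w; rewrite /graph_section/= in_itv/= andbT.
have n0 : 0 < n.+1%:R^-1 :> R by rewrite invr_gt0.
set c : R := n.+1%:R^-1 in n0 *.
have c1 : c <= 1 by rewrite /c invf_le1 ?ler1n.
pose phi t : R := Num.min c (Num.max 0 (t - a)).
apply: (@inner_approximable_zero _ _ _ P F S S0 (fun t w => c - \1_A w * phi t)).
  apply: lipschitz_adapted_indic => //.
  - by rewrite c1 ltW.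
  - by move=> t; rewrite /phi; case: (leP 0 (t - a)) => ?; case: (leP c _); lra.
  - move=> s t; rewrite /phi; have -> : s - t = (s - a) - (t - a) by ring.
    exact: clamp_lipschitz.
  - move=> t t0; have [ta|at_] := leP t a.
      by left; rewrite /phi max_l ?subr_le0// min_r// ltW.
    by right; apply: (FS a t) => //; exact: ltW.
move=> t w t0; rewrite /E/= indicE /phi -/c.
have [Aw|Aw] := pselect (A w).
  rewrite mem_set// mul1r; split => [[h _]|].
    by case: (leP 0 (t - a)) => ?; case: (leP c _); lra.
  by case: (leP 0 (t - a)) => ?; case: (leP c _); split => //; lra.
rewrite memNset//= mul0r subr0; split => [[]//|c0].
by move: n0; rewrite c0 ltxx.
Qed.

(** Here the ramp equals [1] up to time [a] and then decreases to [0]. It is already active at time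
    [0], whence [A] in [F 0]. *)
Lemma inner_approximable_le a A : 0 <= a -> F 0 A ->
  inner [set z | 0 <= z.1 <= a /\ A z.2].
Proof.
move=> a0 FA; have [_ _ FS] := hF.
pose phi t : R := 1 - Num.min 1 (Num.max 0 (t - a)).
apply: (@inner_approximable_zero _ _ _ P F S S0 (fun t w => 1 - \1_A w * phi t)).
  apply: lipschitz_adapted_indic => //.
  - by rewrite lexx ler01.
  - by move=> t; rewrite /phi; case: (leP 0 (t - a)) => ?; case: (leP 1 _); lra.
  - move=> s t; rewrite /phi [leLHS](_ : _ = `|Num.min 1 (Num.max 0 (s - a)) -
      Num.min 1 (Num.max 0 (t - a))|); last by rewrite distrC; congr (`|_|); ring.
    have -> : s - t = (s - a) - (t - a) by ring.
    exact: clamp_lipschitz.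
  - by move=> t t0; right; exact: (FS 0 t).
move=> t w t0; rewrite /= indicE /phi t0/=.
have [Aw|Aw] := pselect (A w).
  rewrite mem_set// mul1r; split => [[h _]|].
    by case: (leP 0 (t - a)) => ?; case: (leP 1 _); lra.
  by case: (leP 0 (t - a)) => ?; case: (leP 1 _); split => //; lra.
rewrite memNset//= mul0r subr0; split => [[]//|/eqP].
by rewrite oner_eq0.
Qed.

Lemma measurable_graph_section_le a A : F 0 A ->
  measurable (graph_section S [set z | 0 <= z.1 <= a /\ A z.2]).
Proof.
move=> FA; have [_ FT _] := hF.
have := measurableI _ _ (mS measurableT (@measurable_itv _ `[0, a])) (FT _ (lexx 0) _ FA).
rewrite setTI; congr (measurable _); apply/seteqP.
Qed.

Let FsetT t : 0 <= t -> F t setT.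
Proof.
have [sF _ _] := hF => t0; have [F0 FC _] := sF t t0.
by rewrite -(setD0 setT); exact: FC.
Qed.

Let FsetC t A : 0 <= t -> F t A -> F t (~` A).
Proof.
have [sF _ _] := hF => t0; have [F0 FC _] := sF t t0.
by rewrite -setTD; exact: FC.
Qed.

Lemma regular_lt a A : 0 <= a -> F a A -> regular_set [set z | a < z.1 /\ A z.2].
Proof.
move=> a0 FA; split.
- by move=> z /= [az _]; rewrite ltW// (le_lt_trans a0).
- exact: measurable_graph_section_lt.
- exact: inner_approximable_lt.
- rewrite (_ : _ `\` _ = [set z | 0 <= z.1 <= a /\ setT z.2] `|` [set z | a < z.1 /\ (~` A) z.2]).
    apply: inner_approximable_setU => //.
    + by apply: measurable_graph_section_le; exact: FsetT.
    + by apply: measurable_graph_section_lt => //; exact: FsetC.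
    + by apply: inner_approximable_le => //; exact: FsetT.
    + by apply: inner_approximable_lt => //; exact: FsetC.
  apply/seteqP; split => [[t w]/= [t0 h]|[t w]/= [[/andP[t0 ta] _]|[at_ nA]]].
  + have [ta|at_] := leP t a; first by left; rewrite t0.
    by right; split => // Aw; apply: h.
  + by split => // -[]; rewrite ltNge ta.
  + by split => [|[_ //]]; rewrite ltW// (le_lt_trans a0).
Qed.

Lemma regular_at0 A : F 0 A -> regular_set [set z | 0 <= z.1 <= 0 /\ A z.2].
Proof.
move=> FA; split.
- by move=> z /= [/andP[]].
- exact: measurable_graph_section_le.
- exact: inner_approximable_le.
- rewrite (_ : _ `\` _ = [set z | 0 <= z.1 <= 0 /\ (~` A) z.2] `|` [set z | 0 < z.1 /\ setT z.2]).
    apply: inner_approximable_setU => //.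
    + by apply: measurable_graph_section_le; exact: FsetC.
    + by apply: measurable_graph_section_lt => //; exact: FsetT.
    + by apply: inner_approximable_le => //; exact: FsetC.
    + by apply: inner_approximable_lt => //; exact: FsetT.
  apply/seteqP; split => [[t w]/= [t0 h]|[t w]/= [[/andP[t0 ta] nA]|[at_ _]]].
  + have [ta|at_] := leP t 0; last by right.
    by left; rewrite t0; split => // Aw; apply: h; rewrite t0.
  + by split => // -[].
  + by split => [|[/andP[_]]]; [exact: ltW|rewrite leNgt at_].
Qed.

Lemma sigma_algebra_regular : sigma_algebra D0 regular_set.
Proof.
split.
- have -> : set0 = [set z : R * T | 0 < z.1 /\ set0 z.2].
    by apply/seteqP; split => z // [].
  apply: regular_lt => //; have [sF _ _] := hF.
  by have [] := sF 0 (lexx _).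
- move=> A [AD mA iA iA']; split => //.
  + rewrite (_ : graph_section S _ = ~` graph_section S A); first exact: measurableC.
    by apply/seteqP; split => w /=; [case|split => //=].
  + by rewrite setDD setIidr.
- move=> A hA.
  have mA n : measurable (graph_section S (A n)) by have [] := hA n.
  have mA' n : measurable (graph_section S (D0 `\` A n)).
    rewrite (_ : graph_section S _ = ~` graph_section S (A n)); first exact: measurableC.
    by apply/seteqP; split => w /=; [case|split => //=].
  split.
  + by move=> z [n _ Az]; have [+ _ _ _] := hA n; apply.
  + by apply: bigcup_measurable => k _; exact: mA.
  + by apply: inner_approximable_bigcup => // n; have [] := hA n.
  + have -> : D0 `\` \bigcup_k A k = \bigcap_k (D0 `\` A k).
      apply/seteqP; split => [z [Dz nA] k _|z Az].
        by split => // Ak; apply: nA; exists k.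
      by split => [|[k _ Ak]]; [have [] := Az 0%N I|have [_] := Az k I].
    by apply: inner_approximable_bigcap => // n; have [] := hA n.
Qed.

End predictable_regularity.

(** * Discretisation of time by left end points *)

Section left_grid.
Context {R : realType}.
Local Open Scope classical_set_scope.
Local Open Scope ring_scope.

(** The cells are open on the left and closed on the right, so the left end point of the cell of
    [t > 0] lies strictly before [t]. The truncated predecessor sends time [0] to cell [0]. *)
Definition grid_index n (t : R) : nat := `|Num.ceil (t * n.+1%:R)|%N.-1.

Lemma grid_indexP n (t : R) (k : nat) : 0 < t ->
  (grid_index n t = k) <-> (k%:R / n.+1%:R < t <= k.+1%:R / n.+1%:R).
Proof.
move=> t0; have x0 : 0 < t * n.+1%:R by rewrite mulr_gt0.
rewrite ltr_pdivrMr// ler_pdivlMr// /grid_index.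
have c0 : (0 < Num.ceil (t * n.+1%:R))%R by rewrite ceil_gt0.
split=> [<-|h].
  have := ceil_itv (t * n.+1%:R).
  case: (Num.ceil (t * n.+1%:R)) c0 => // -[//|m] _ /=.
  by rewrite -addn1 PoszD addrK.
suff -> : Num.ceil (t * n.+1%:R) = k.+1 by [].
by apply: ceil_def; rewrite -addn1 PoszD addrK -PoszD addn1.
Qed.

Lemma grid_index0 n : grid_index n (0 : R) = 0%N.
Proof. by rewrite /grid_index mul0r ceil0. Qed.

End left_grid.

(** * Predictable sets are regular *)

Section predictable_regularity.
Context {d : measure_display} {T : measurableType d} {R : realType}.
Local Open Scope classical_set_scope.
Local Open Scope ring_scope.
Variables (P : probability T R) (F : R -> set (set T)) (S : T -> R).
Hypotheses (hF : is_filtration F) (mS : measurable_fun setT S)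
  (S0 : forall w, 0 <= S w).

Local Notation D0 := [set z : R * T | 0 <= z.1].

(** Regular sets form a sigma-algebra on [D0] only. Passing to traces gives one on all of [R * T],
    for which measurable functions are available. *)
Let M : set (set (R * T)) := [set E | regular_set P F S (E `&` D0)].

Let sM : sigma_algebra setT M.
Proof.
have [s0 sC sU] := sigma_algebra_regular P hF mS S0.
split; rewrite /M /=.
- by rewrite set0I.
- move=> A /sC; congr (regular_set P F S _).
  by rewrite setTD setDIr setDv setU0 setIC -setDE.
- by move=> A hA; rewrite setI_bigcupl; exact: sU.
Qed.

Let mM (E : set (g_sigma_algebraType M)) : measurable E = M E.
Proof. by have := measurable_g_measurableTypeE sM => ->. Qed.

Let mD0 : measurable (D0 : set (g_sigma_algebraType M)).
Proof.
rewrite mM /M/= setIid; have [s0 sC sU] := sigma_algebra_regular P hF mS S0.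
by have := sC _ s0; rewrite setD0.
Qed.

Let mlt a A : 0 <= a -> F a A ->
  measurable ([set z | a < z.1 /\ A z.2] : set (g_sigma_algebraType M)).
Proof.
move=> a0 FA; have h := regular_lt P hF mS S0 a0 FA.
by rewrite mM /M/= setIidl//; have [] := h.
Qed.

Let mat0 A : F 0 A ->
  measurable ([set z | 0 <= z.1 <= 0 /\ A z.2] : set (g_sigma_algebraType M)).
Proof.
move=> FA; have h := regular_at0 P hF mS S0 FA.
by rewrite mM /M/= setIidl//; have [] := h.
Qed.

Lemma regular_left_continuous (H : R -> T -> R) (B : set R) : adapted F H ->
  left_continuous_process H -> measurable B ->
  regular_set P F S (process_preimage H B).
Proof.
move=> aH lH mB.
suff mH : measurable_fun (D0 : set (g_sigma_algebraType M))
    ((fun z => H z.1 z.2) : g_sigma_algebraType M -> R).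
  have := mH mD0 B mB; rewrite mM /M/=; congr (regular_set P F S _).
  by apply/seteqP; split => [z [[]]|z [z0 Bz]].
apply: (@measurable_fun_cvg _ (g_sigma_algebraType M) R D0
   (fun n z => H ((grid_index n z.1)%:R / n.+1%:R) z.2)); last first.
  move=> [t w]; rewrite /= le_eqVlt => /predU1P[<-|t0].
    rewrite (_ : (fun _ => _) = cst (H 0 w)); first exact: cvg_cst.
    by apply/funext => n; rewrite grid_index0 mul0r.
  have /cvg_at_leftP := lH w t t0; apply.
  have k n := (grid_indexP n (grid_index n t) t0).1 erefl.
  split=> [n|]; first by have /andP[] := k n.
  apply: cvg_dist_harmonic => n; have /andP[k1 k2] := k n.
  rewrite distrC ger0_norm; last by rewrite subr_ge0 ltW.
  rewrite lerBlDl (le_trans k2)//.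
  by rewrite -addn1 natrD mulrDl mul1r.
move=> n.
pose E k : set (g_sigma_algebraType M) := [set z | 0 <= z.1 /\ grid_index n z.1 = k].
have mEA k A : F (k%:R / n.+1%:R) A -> measurable (E k `&` [set z | A z.2]).
  move=> FA; have [_ _ FS] := hF.
  have c0 m : 0 <= m%:R / n.+1%:R :> R by rewrite divr_ge0.
  have cc : k%:R / n.+1%:R <= k.+1%:R / n.+1%:R :> R.
    by rewrite ler_pM2r ?invr_gt0// ler_nat.
  have hpos : measurable ([set z | k%:R / n.+1%:R < z.1 /\ A z.2] `\`
      [set z | k.+1%:R / n.+1%:R < z.1 /\ A z.2] : set (g_sigma_algebraType M)).
    by apply: measurableD; apply: mlt => //; exact: FS FA.
  (* Each cell is a difference of two sets of the form [mlt], except that cell [0] also contains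
     time [0], which [mat0] adds. *)
  have [k0|k0] := eqVneq k 0%N.
    have h0 : F 0 A by move: FA; rewrite k0 mul0r.
    have := measurableU _ _ (mat0 h0) hpos; congr (measurable _).
    rewrite k0; apply/seteqP; split => [[t w]/=|[t w]/=].
      rewrite -eq_le; case=> [[/eqP <- Aw]|]; first by split => //; split; rewrite ?grid_index0 /=.
      move=> [[t0 Aw] tn]; have {}t0 : 0 < t by move: t0; rewrite mul0r.
      split => //; split => /=; first exact: ltW.
      by apply/grid_indexP => //; rewrite mul0r t0 leNgt; apply/negP => h; apply: tn.
    move=> [[/= t0 +] Aw]; move: t0; rewrite le_eqVlt => /predU1P[<- _|t0].
      by left; rewrite eqxx lexx.
    move/(grid_indexP _ _ t0) => /andP[h1 h2]; right; split => // -[].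
    by rewrite ltNge h2.
  move: hpos; congr (measurable _).
  have kn0 : 0 < k%:R / n.+1%:R :> R by rewrite divr_gt0// ltr0n lt0n.
  apply/seteqP; split => [[t w]/= [[kt Aw] tn]|[t w]/= [[/= t0 tk] Aw]].
    have t0 := lt_trans kn0 kt; split => //; split => /=; first exact: ltW.
    by apply/grid_indexP => //; rewrite kt leNgt; apply/negP => h; apply: tn.
  move: t0; rewrite le_eqVlt => /predU1P[t0|t0].
    by move: tk k0; rewrite -t0 grid_index0 => <-; rewrite eqxx.
  move/(grid_indexP _ _ t0) : tk => /andP[h1 h2]; split => // -[].
  by rewrite ltNge h2.
have FsetT t : 0 <= t -> F t setT.
  have [sF _ _] := hF => t0; have [F0 FC _] := sF t t0.
  by rewrite -(setD0 setT); exact: FC.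
have c0 m : 0 <= m%:R / n.+1%:R :> R by rewrite divr_ge0.
have mE k : measurable (E k) by have := mEA k setT (FsetT _ (c0 k)); rewrite setIT.
have -> : D0 = \bigcup_k E k.
  by apply/seteqP; split => [z z0|z [k _ []//]]; exists (grid_index n z.1).
apply/measurable_fun_bigcup => // k.
apply: (@eq_measurable_fun _ _ (g_sigma_algebraType M) _ (E k)
  (fun z => H (k%:R / n.+1%:R) z.2)).
  by move=> z; rewrite inE => -[_ ->].
move=> _ C mC; apply: (mEA k (H (k%:R / n.+1%:R) @^-1` C)); have [sF _ _] := hF.
exact: ((measurable_wrtP _ (sF _ (c0 k))).1 (aH _ (c0 k))).
Qed.

Theorem predictable_regular D : predictable_sets F D -> regular_set P F S D.
Proof.
apply: smallest_sub; first exact: sigma_algebra_regular.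
by move=> _ [H [B [aH lH mB ->]]]; exact: regular_left_continuous.
Qed.

End predictable_regularity.

(** * Announcing the hitting times of a predictable process *)

Section real_paths.
Context {R : realType}.
Local Open Scope classical_set_scope.
Local Open Scope ring_scope.

Lemma archi_div_lt (c e : R) : 0 < e -> exists n : nat, c / n.+1%:R < e.
Proof.
move=> e0; exists (Num.truncn (c / e)).
by rewrite ltr_pdivrMr// mulrC -ltr_pdivrMr// truncnS_gt.
Qed.

(** A 1-Lipschitz path that is below [c] at [t] stays below on a window of length [c - h t] after
    [t], and a rational is picked there. Existence over all times thus becomes a countable union. *)
Lemma lipschitz_rational_lt (h : R -> R) (c : R) (s : \bar R) :
  (forall a b, `|h a - h b| <= `|a - b|) ->
  (exists t, [/\ 0 <= t, (t%:E < s)%E & h t < c]) ->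
  exists q : rat, [/\ 0 <= ratr q :> R, ((ratr q : R)%:E < s)%E & h (ratr q) < c].
Proof.
move=> lh [t [t0 ts htc]].
have [u [tu ut us]] : exists u, [/\ t < u, u <= t + (c - h t) & (u%:E <= s)%E].
  case: s ts => [s| |]//=; last first.
    by move=> _; exists (t + (c - h t)); rewrite leey; split=> //; lra.
  rewrite lte_fin => ts; exists (Num.min s (t + (c - h t))).
  by rewrite lt_min ts ge_min lexx orbT lee_fin ge_min lexx; split => //=; lra.
have [q] := rat_in_itvoo tu; rewrite in_itv/= => /andP[tq qu].
exists q; split; first by rewrite ltW// (le_lt_trans t0).
  by apply: lt_le_trans us; rewrite lte_fin.
have := lh (ratr q) t; rewrite (@gtr0_norm _ (ratr q - t)) ?subr_gt0//.
by rewrite ler_norml; lra.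
Qed.

Variables (g : R -> R) (l : R).
Hypotheses (g_nd : forall s t, 0 <= s -> s <= t -> g s <= g t)
  (g_rc : forall t, 0 <= t -> g s @[s --> t^'+] --> g t).

(* [hitting_time] is [0] when the level [l] is never reached. *)
Definition hitting_time : R := inf [set t | 0 <= t /\ l <= g t].

Let lb : has_lbound [set t | 0 <= t /\ l <= g t].
Proof. by exists 0 => t []. Qed.

Lemma hitting_time_ge0 : 0 <= hitting_time.
Proof.
have [h|h] := pselect ([set t | 0 <= t /\ l <= g t] !=set0).
  by apply: lb_le_inf => // t [].
by move/set0P/negP/negPn/eqP: h; rewrite /hitting_time => ->; rewrite inf0.
Qed.

Lemma hitting_time_le t : 0 <= t -> l <= g t -> hitting_time <= t.
Proof. by move=> t0 lt; apply: ge_inf. Qed.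

(** If [g] were below [l] at the infimum, right-continuity would keep it below just afterwards,
    although the infimum is approached by times at which the level is reached. *)
Lemma hitting_time_reached : (exists t, 0 <= t /\ l <= g t) ->
  l <= g hitting_time.
Proof.
move=> [t0 ht0]; rewrite leNgt; apply/negP => gl.
have /cvgrPdist_lt := g_rc hitting_time_ge0.
have e0 : 0 < l - g hitting_time by rewrite subr_gt0.
move=> /(_ _ e0); rewrite near_withinE => -[e /= e1 he].
have hinf : has_inf [set t | 0 <= t /\ l <= g t] by split => //; exists t0.
have [t [tpos lt] te] := inf_adherent e1 hinf.
have [tS|tS] := ltP hitting_time t; last first.
  by have := g_nd tpos tS; lra.
have := he t; rewrite /ball/= distrC gtr0_norm ?subr_gt0// => /(_ _ tS).
have -> : t - hitting_time < e by rewrite ltrBlDl.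
move=> /(_ isT); rewrite distrC ltr_norml => /andP[_]; lra.
Qed.

End real_paths.

(** * Stopping times under the usual conditions *)

Section stopping_times.
Context {d : measure_display} {T : measurableType d} {R : realType}.
Local Open Scope classical_set_scope.
Local Open Scope ring_scope.
Variables (P : probability T R) (F : R -> set (set T)).
Hypothesis hF : usual_conditions P F.
Implicit Types (tau : T -> \bar R).

Lemma filtration_bigcup t (A : nat -> set T) : 0 <= t ->
  (forall n, F t (A n)) -> F t (\bigcup_n A n).
Proof.
have [[sF _ _] _ _] := hF => t0; have [_ _ h] := sF t t0; exact: h.
Qed.

Lemma filtration_setC t (A : set T) : 0 <= t -> F t A -> F t (~` A).
Proof.
have [[sF _ _] _ _] := hF => t0; have [_ h _] := sF t t0.
by rewrite -setTD; exact: h.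
Qed.

Lemma filtration_bigcap t (A : nat -> set T) : 0 <= t ->
  (forall n, F t (A n)) -> F t (\bigcap_n A n).
Proof.
move=> t0 h; rewrite -[X in F t X]setCK setC_bigcap.
apply: filtration_setC => //; apply: filtration_bigcup => // n.
exact: filtration_setC.
Qed.

Lemma stopping_time_lt tau t : stopping_time F tau -> 0 <= t ->
  F t [set w | (tau w < t%:E)%E].
Proof.
have [[sF _ FS] _ _] := hF; move=> [tau0 Ftau].
rewrite le_eqVlt => /predU1P[<-|t0].
  have [h _ _] := sF 0 (lexx _); congr (F 0 _) : h.
  by apply/seteqP; split => // w /=; rewrite ltNge tau0.
(* Steps proportional to [t] keep all these times in [[0, t[]. *)
rewrite (_ : [set _ | _] = \bigcup_n [set w | (tau w <= (t - t / n.+1%:R)%:E)%E]).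
  have tn n : 0 <= t - t / n.+1%:R.
    by rewrite subr_ge0 ler_pdivrMr// ler_peMr ?ler1n// ltW.
  apply: filtration_bigcup => [|n]; first exact: ltW.
  apply: (FS (t - t / n.+1%:R)) => //; last exact: Ftau.
  by rewrite gerBl divr_ge0// ltW.
apply/seteqP; split => w /=; last first.
  by move=> [n _ /le_lt_trans]; apply; rewrite lte_fin gtrBl divr_gt0.
have := tau0 w; case Er: (tau w) => [r| |]//=; rewrite lte_fin => r0 rt.
have rt0 : 0 < t - r by rewrite subr_gt0.
have [n hn] := archi_div_lt t rt0.
by exists n => //; rewrite /= Er lee_fin lerBrDr -lerBrDl ltW.
Qed.

(** By right-continuity of the filtration it suffices to place [tau <= t] in [F s] for every
    [s > t], as an intersection of events [tau < u] with [t < u <= s]. *)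
Lemma stopping_time_of_lt tau : (forall w, (0 <= tau w)%E) ->
  (forall t, 0 < t -> F t [set w | (tau w < t%:E)%E]) -> stopping_time F tau.
Proof.
have [[_ _ FS] Frc _] := hF; move=> tau0 h; split => // t t0.
rewrite Frc// => s /= ts.
have st0 : 0 < s - t by rewrite subr_gt0.
have s0 : 0 <= s by rewrite ltW// (le_lt_trans t0).
rewrite (_ : [set _ | _] =
    \bigcap_n [set w | (tau w < (t + (s - t) / n.+1%:R)%:E)%E]).
  apply: filtration_bigcap => // n.
  have p0 : 0 < t + (s - t) / n.+1%:R by rewrite ltr_wpDl// divr_gt0.
  apply: (FS (t + (s - t) / n.+1%:R)); [exact: ltW| |exact: h].
  by rewrite -lerBrDl ler_pdivrMr// ler_peMr ?ler1n// ltW.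
apply/seteqP; split => w /=.
  by move=> /le_lt_trans h1 n _; apply: h1; rewrite lte_fin ltrDl divr_gt0.
have := tau0 w; case Er: (tau w) => [r| |]//= r0 hr; last first.
  by have := hr 0%N I; rewrite /= Er.
rewrite lee_fin leNgt; apply/negP => tr; have rt0 : 0 < r - t by rewrite subr_gt0.
have [n hn] := archi_div_lt (s - t) rt0.
by have := hr n I; rewrite /= Er lte_fin addrC -ltrBlDr ltNge ltW.
Qed.

Lemma measurable_stopping_time tau : stopping_time F tau ->
  measurable_fun setT tau.
Proof.
have [[_ FT _] _ _] := hF; move=> [tau0 Ftau].
apply: (measurability _ (ErealGenInftyO.measurableE R)) => //.
move=> _ [_ [r ->] <-]; rewrite setTI.
have [r0|r0] := leP r 0.
  rewrite (_ : _ @^-1` _ = set0) //; rewrite -subset0 => w /=.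
  by rewrite in_itv/= => /(le_lt_trans (tau0 w)); rewrite lte_fin ltNge r0.
apply: (FT r); first exact: ltW.
have := stopping_time_lt (conj tau0 Ftau) (ltW r0); congr (F r _).
Qed.

Lemma measurable_adapted t (X : R -> T -> R) : adapted F X -> 0 <= t ->
  measurable_fun setT (X t).
Proof.
have [[sF FT _] _ _] := hF => aX t0.
exact: measurable_wrt_le (sF _ t0) (FT _ t0) (aX _ t0).
Qed.

Lemma filtration_preimage t (X : R -> T -> R) (B : set R) : adapted F X ->
  0 <= t -> measurable B -> F t (X t @^-1` B).
Proof.
have [[sF _ _] _ _] := hF => aX t0 mB.
exact: ((measurable_wrtP _ (sF _ t0)).1 (aX _ t0)).
Qed.

End stopping_times.

(** * Measurability of stopped processes and hitting times *)

Section stopped_processes.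
Context {d : measure_display} {T : measurableType d} {R : realType}.
Local Open Scope classical_set_scope.
Local Open Scope ring_scope.
Implicit Types (X G : R -> T -> R) (tau : T -> \bar R).

Lemma measurable_sup_process G :
  (forall t, 0 <= t -> measurable_fun setT (G t)) ->
  nondecreasing_process G -> measurable_fun setT (sup_process G).
Proof.
move=> mG ndG.
apply: (@emeasurable_fun_cvg _ _ _ _ (fun n w => (G n%:R w)%:E)).
  by move=> n; apply/measurable_EFinP; exact: mG.
move=> w _.
have -> : sup_process G w = ereal_sup (range (fun n => (G n%:R w)%:E)).
  apply/eqP; rewrite eq_le; apply/andP; split; last first.
    by apply: ereal_sup_le => _ [n _ <-]; exists n%:R => //=.
  apply: ge_ereal_sup => _ [t /= t0 <-].
  apply: le_ereal_sup_tmp; exists (G (Num.truncn t).+1%:R w)%:E; first by exists (Num.truncn t).+1.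
  by rewrite lee_fin ndG// ltW// truncnS_gt.
apply: ereal_nondecreasing_cvgn => m n mn.
by rewrite lee_fin ndG// ler_nat.
Qed.

Lemma measurable_stopped X Xoo tau : right_continuous_process X ->
  (forall t, 0 <= t -> measurable_fun setT (X t)) ->
  measurable_fun setT Xoo -> measurable_fun setT tau ->
  (forall w, (0 <= tau w)%E) -> measurable_fun setT (stopped X Xoo tau).
Proof.
move=> rX mX mXoo mtau tau0.
rewrite (_ : stopped X Xoo tau =
  fun w => if tau w == +oo%E then Xoo w else (X (fine (tau w)) w)%:E); last first.
  apply/funext => w; rewrite /stopped; have := tau0 w.
  by case: (tau w) => [s| |].
apply: measurable_fun_ifT => //.
  apply: (measurable_fun_bool true); rewrite setTI.
  rewrite (_ : _ @^-1` _ = tau @^-1` [set +oo%E]).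
    by rewrite -[X in measurable X]setTI; apply: mtau.
  by apply/seteqP; split => w /= /eqP.
apply/measurable_EFinP; apply: measurable_right_continuous_at => //.
  by apply: (measurableT_comp (@fine_measurable R setT measurableT)).
by move=> w; exact: fine_ge0.
Qed.

Lemma measurable_hitting_time G l : right_continuous_process G ->
  (forall t, 0 <= t -> measurable_fun setT (G t)) -> nondecreasing_process G ->
  measurable_fun setT (fun w => hitting_time (G^~ w) l).
Proof.
move=> rG mG ndG.
apply: (measurability _ (RGenOInfty.measurableE R)) => //.
move=> _ [_ [x ->] <-]; rewrite setTI.
have ge0 w : 0 <= hitting_time (G^~ w) l by exact: hitting_time_ge0.
have [x0|x0] := ltP x 0.
  rewrite (_ : _ @^-1` _ = setT) //; apply/seteqP; split => w //= _.
  by rewrite in_itv/= andbT (lt_le_trans x0).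
have mset t : 0 <= t -> measurable [set w | l <= G t w].
  move=> t0; rewrite (_ : [set _ | _] = setT `&` G t @^-1` `[l, +oo[).
    exact: mG.
  by rewrite setTI; apply/seteqP; split => w /=; rewrite in_itv/= andbT.
(* For [x >= 0] the hitting time exceeds [x] when the level is reached eventually but not yet at
   [x]. The first condition excludes paths that never reach it, whose hitting time is [0] by
   convention. *)
rewrite (_ : _ @^-1` _ = (\bigcup_n [set w | l <= G n%:R w]) `&` ~` [set w | l <= G x w]).
  apply: measurableI; last exact/measurableC/mset.
  by apply: bigcupT_measurable => n; exact: mset.
apply/seteqP; split => w /=; rewrite in_itv/= andbT.
  move=> xS; have [[t [t0 lt]]|h] := pselect (exists t, 0 <= t /\ l <= G t w).
    split; last by move=> lx; move: xS; rewrite ltNge hitting_time_le.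
    exists (Num.truncn t).+1 => //=; apply: le_trans lt _.
    by rewrite ndG// ltW// truncnS_gt.
  move: xS; rewrite /hitting_time (_ : [set _ | _] = set0) ?inf0 ?ltNge ?x0//.
  by rewrite -subset0 => t /= ht; apply: h; exists t.
move=> [[n _ /= ln] nlx]; rewrite ltNge; apply/negP => Sx; apply: nlx.
apply: (@le_trans _ _ (G (hitting_time (G^~ w) l) w)).
  apply: (@hitting_time_reached _ (G^~ w)) => [s t|t|].
  - exact: ndG.
  - exact: rG.
  - by exists n%:R.
by apply: ndG.
Qed.

End stopped_processes.

(** * The announcing sequence *)

Section announcing.
Context {d : measure_display} {T : measurableType d} {R : realType}.
Local Open Scope classical_set_scope.
Local Open Scope ring_scope.
Variables (P : probability T R) (F : R -> set (set T)).
Hypothesis hF : usual_conditions P F.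
Implicit Types (tau : T -> \bar R).

Lemma lim_sup_set_null (A : nat -> set T) : (forall n, measurable (A n)) ->
  (forall n, (P (A n) <= (1 / (2 ^ n.+1)%:R)%:E)%E) -> P (lim_sup_set A) = 0%E.
Proof.
move=> mA PA; apply: lim_sup_set_cvg0 => //.
apply: (@le_lt_trans _ _ 1%E); last by rewrite ltry.
apply: le_trans (epsilon_trick0 xpredT ler01).
by apply: lee_nneseries => // n *; exact: PA.
Qed.

Lemma not_lim_sup_set (A : nat -> set T) w : ~ lim_sup_set A w ->
  exists K, forall k, (K <= k)%N -> ~ A k w.
Proof.
move=> h; apply: contrapT => nK; apply: h => n _.
apply: contrapT => nA; apply: nK; exists n => k nk Ak; apply: nA.
by exists k.
Qed.

Section debut.
Variables (H : nat -> R -> T -> R) (del : nat -> R) (tau : T -> \bar R).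
Hypotheses (lH : forall k, lipschitz_adapted F (H k))
  (htau : stopping_time F tau).

(** The first alternative makes the set non-empty and the debut bounded by [n]; the second caps the
    debut by [tau]; the third sounds an alarm before any positive zero of [H k], for all [k >= n] at
    once. *)
Definition debut_set n w : set R := [set t | 0 <= t /\
  [\/ n%:R <= t, (tau w <= t%:E)%E | exists2 k, (n <= k)%N & H k t w < del k]].

Definition debut n w : R := inf (debut_set n w).

Let debut_set_lb n w : has_lbound (debut_set n w).
Proof. by exists 0 => t []. Qed.

Let debut_set_n n w : debut_set n w n%:R.
Proof. by split => //; apply: Or31. Qed.

Lemma debut_ge0 n w : 0 <= debut n w.
Proof. by apply: lb_le_inf => [|t []//]; exists n%:R. Qed.

Lemma debut_le n w t : debut_set n w t -> debut n w <= t.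
Proof. exact: ge_inf. Qed.

Lemma debut_le_nat n w : debut n w <= n%:R.
Proof. exact: debut_le. Qed.

Lemma debut_le_time n w : ((debut n w)%:E <= tau w)%E.
Proof.
have [tau0 _] := htau; have := tau0 w; case E: (tau w) => [s| |]// s0; last exact: leey.
by rewrite lee_fin; apply: debut_le; split => //; apply: Or32; rewrite E.
Qed.

(** The event that the debut is before [t] reduces to rational times, since the [H k] are Lipschitz;
    right-continuity of the filtration then passes from strict to weak inequalities. *)
Lemma debut_stopping_time n : stopping_time F (EFin \o debut n).
Proof.
apply: (stopping_time_of_lt hF) => [w|t t0]; first by rewrite lee_fin debut_ge0.
have [[sF FT FS] _ _] := hF.
have FE (E : set T) : F t E = measurable (E : set (g_sigma_algebraType (F t))).
  by rewrite (measurable_g_measurableTypeE (sF t (ltW t0))).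
pose Q k (q : rat) := [set w | [/\ 0 <= ratr q :> R,
   ((ratr q : R)%:E < t%:E)%E & H k (ratr q) w < del k]].
rewrite (_ : [set _ | _] = [set w | n%:R < t] `|` [set w | (tau w < t%:E)%E] `|`
    \bigcup_(k in [set k | (n <= k)%N]) \bigcup_q Q k q); last first.
  apply/seteqP; split => w /=; rewrite lte_fin.
    move=> /inf_lt[|u [u0 Uu] ut]; first by exists n%:R.
    case: Uu => [nu|tu|[k nk Hk]].
    - by left; left; exact: le_lt_trans ut.
    - by left; right; apply: le_lt_trans tu _; rewrite lte_fin.
    - right; exists k => //; have [_ lHk _] := lH k.
      have [|q hq] := @lipschitz_rational_lt _ (H k ^~ w) (del k) t%:E (fun a b => lHk a b w).
        by exists u; split; rewrite ?lte_fin.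
      by exists q.
  case=> [[nt|]|[k nk [q _ [q0 qt Hq]]]].
  - by apply: le_lt_trans nt; exact: debut_le_nat.
  - by rewrite -lte_fin; apply: le_lt_trans; exact: debut_le_time.
  - apply: (@le_lt_trans _ _ (ratr q)); last by rewrite -lte_fin.
    by apply: debut_le; split => //; apply: Or33; exists k.
rewrite FE; apply: measurableU; first apply: measurableU.
- have [nt|nt] := pselect (n%:R < t).
    by rewrite (_ : [set _ | _] = setT)//; apply/seteqP; split.
  by rewrite (_ : [set _ | _] = set0)//; apply/seteqP; split.
- by rewrite -FE; apply: (stopping_time_lt hF htau); exact: ltW.
- apply: bigcup_measurable => k _; apply: bigcupT_measurable_rat => q.
  have [q0|q0] := pselect (0 <= ratr q :> R); last first.
    by rewrite (_ : Q k q = set0)//; apply/seteqP; split => // w [].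
  have [qt|qt] := pselect ((ratr q : R)%:E < t%:E)%E; last first.
    by rewrite (_ : Q k q = set0)//; apply/seteqP; split => // w [].
  have [_ _ aH] := lH k.
  rewrite -FE; apply: (FS (ratr q)); [exact: q0|by apply: ltW; rewrite -lte_fin|].
  have := filtration_preimage hF aH q0 (@measurable_itv _ `]-oo, (del k)[).
  congr (F _ _); apply/seteqP; split => w; rewrite /Q/= in_itv/= //.
  by case.
Qed.

End debut.

(** The hitting time of [l] does not appear in the statement: that [sigma n] comes before it is
    expressed by [G] being still below [l] at [sigma n]. The sequence is also capped by [tau], and
    it settles at [tau] when [tau] is finite and comes before the hitting time. *)
Lemma predictable_hitting_time_announced (G : R -> T -> R) (l : R)
    (tau : T -> \bar R) :
  adapted F G -> right_continuous_process G -> nondecreasing_process G ->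
  predictable F G -> stopping_time F tau ->
  exists (sigma : nat -> T -> R) (N : set T), P.-negligible N /\ [/\
    forall n, stopping_time F (EFin \o sigma n),
    forall n w, sigma n w <= n%:R,
    forall n w, ((sigma n w)%:E <= tau w)%E,
    forall w, ~ N w -> G 0 w < l -> forall n, G (sigma n w) w < l &
    forall w, ~ N w -> forall s, tau w = s%:E -> G s w < l ->
      exists K, forall n, (K <= n)%N -> sigma n w = s].
Proof.
move=> aG rG ndG pG htau.
have [hFil _ _] := hF; have [sF FT FS] := hFil.
have [tau0 _] := htau.
have mG t : 0 <= t -> measurable_fun setT (G t).
  by move=> t0; have := measurable_adapted hF aG t0; exact.
pose S w := hitting_time (G^~ w) l.
have mS : measurable_fun setT S by exact: (@measurable_hitting_time _ _ _ G l rG mG ndG).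
have S0 w : 0 <= S w by exact: hitting_time_ge0.
pose D := process_preimage G `[l, +oo[%classic.
have DE t w : D (t, w) <-> 0 <= t /\ l <= G t w.
  by rewrite /D /process_preimage /= in_itv/= andbT.
have [_ mD iD _] : regular_set P F S D.
  by apply: predictable_regular => //; exact: pG.
have half n : 0 < 1 / (2 ^ n.+1)%:R :> R by rewrite divr_gt0// ltr0n expn_gt0.
have /choice[H hH] k := iD _ (half k).
have lH k : lipschitz_adapted F (H k) by have [] := hH k.
have HD k t w : 0 <= t -> H k t w = 0 -> l <= G t w.
  by move=> t0 Ht; have [_ h _] := hH k; have [] := (DE t w).1 (h _ _ t0 Ht).
pose N1 := lim_sup_set (fun k => missed_section S D (H k)).
have mmiss k : measurable (missed_section S D (H k)).
  by apply: measurableI => //; exact: measurable_lipschitz_neq0 (lH k).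
have PN1 : P N1 = 0%E.
  by apply: lim_sup_set_null => // n; have [_ _ h] := hH n; exact: h.
(* On [A] the level is not yet reached at [tau]. The value [0] at infinity is a placeholder,
   excluded by the first condition. *)
pose A := [set w | (tau w < +oo)%E /\ (stopped G (cst 0%E) tau w < l%:E)%E].
have mtau := measurable_stopping_time hF htau.
have mA : measurable A.
  have mst := @measurable_stopped _ T R G (cst 0%E) tau rG mG (@measurable_cst _ _ _ _ _ _) mtau tau0.
  apply: (@measurableI _ _ [set w | (tau w < +oo)%E]
    [set w | (stopped G (cst 0%E) tau w < l%:E)%E]).
    by rewrite -[X in measurable X]setTI; exact: emeasurable_fun_infty_o.
  by rewrite -[X in measurable X]setTI; exact: emeasurable_fun_infty_o.
pose V k m := A `&` [set w | exists t, [/\ 0 <= t, (t%:E < tau w)%E & H k t w < m.+1%:R^-1]].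
have mV k m : measurable (V k m).
  apply: measurableI => //.
  rewrite (_ : [set _ | _] = \bigcup_(q : rat) [set w | [/\ 0 <= ratr q :> R,
    ((ratr q : R)%:E < tau w)%E & H k (ratr q) w < m.+1%:R^-1]]); last first.
    apply/seteqP; split => w /=.
      have [_ lHk _] := lH k.
      by move/(@lipschitz_rational_lt _ (H k ^~ w) _ _ (fun a b => lHk a b w)) => [q hq]; exists q.
    by move=> [q _ hq]; exists (ratr q).
  apply: bigcupT_measurable_rat => q.
  have [q0|q0] := pselect (0 <= ratr q :> R); last first.
    by rewrite (_ : [set _ | _] = set0)//; apply/seteqP; split => // w [].
  have [_ _ aH] := lH k.
  have := measurableI _ _ (emeasurable_fun_o_infty measurableT mtau (ratr q)%:E)
    (measurable_adapted hF aH q0 measurableT (@measurable_itv _ `]-oo, (m.+1%:R^-1)[)).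
  rewrite !setTI; congr (measurable _); apply/seteqP; split => w /=; rewrite in_itv/=.
    by case.
  by case.
have dV k : nonincreasing_seq (V k).
  move=> m n mn; apply/subsetPset => w [Aw [t [t0 tt Ht]]]; split => //.
  exists t; split => //; apply: lt_le_trans Ht _.
  by rewrite lef_pV2 ?posrE// ler_nat.
(* On the compact interval up to [tau] the continuous path of [H k] attains its minimum. It is
   positive, since a zero of [H k] would force [G] to reach [l] by [tau]; hence some [1/(m+1)] lies
   below the whole path. *)
have V0 k : \bigcap_m V k m = set0.
  rewrite -subset0 => w Vw; have [[] + + _] := Vw 0%N I.
  have := tau0 w; rewrite /stopped; case E: (tau w) => [s| |]//.
  rewrite lee_fin lte_fin => s0 _ Gs.
  have [_ lHk _] := lH k; have [H01 _ _] := lH k.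
  have cH : {within `[0, s], continuous (H k ^~ w)}.
    apply: continuous_subspaceT => t; apply/cvgrPdist_le => e e0; near=> u.
    by rewrite (le_trans (lHk _ _ _))//; near: u; exact: cvgr_dist_le.
  have [c] := EVT_min s0 cH; rewrite in_itv/= => /andP[c0 cs] cmin.
  have Hc : 0 < H k c w.
    rewrite lt_neqAle; have /andP[-> _] := H01 c w; rewrite andbT eq_sym.
    apply/eqP => /(HD _ _ _ c0) lG; have := ndG _ _ w c0 cs.
    by rewrite leNgt (lt_le_trans Gs).
  have [m _ /(_ m (leqnn _)) hm] := near_infty_natSinv_lt (PosNum Hc).
  have [_ [t [t0 ts Ht]]] := Vw m I.
  have {}ts : t <= s by rewrite -lee_fin -E ltW.
  have := cmin t; rewrite in_itv/= t0 ts => /(_ isT).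
  by rewrite leNgt (lt_trans Ht hm).
have /choice[m hm] k := exists_measure_le P (mV k) (dV k) (V0 k) (half k).
pose N2 := lim_sup_set (fun k => V k (m k)).
have PN2 : P N2 = 0%E by apply: lim_sup_set_null.
pose del k : R := (m k).+1%:R^-1.
have del0 k : 0 < del k by rewrite invr_gt0.
(* With S the hitting time of l: outside [N1] the graph of S lies in the zero set
   of [H k] for large k, so [debut n < S]; outside [N2], tau < S forces
   [del k <= H k] on [0, tau[ for large k, so [debut n = tau]. *)
exists (debut H del tau), (N1 `|` N2); split.
  apply: negligibleU; apply/negligibleP => //; apply: bigcap_measurable => // n _;
    exact: bigcup_measurable.
split.
- by move=> n; exact: debut_stopping_time.
- by move=> n w; exact: debut_le_nat.
- by move=> n w; exact: debut_le_time.
- move=> w /not_orP[nN1 _] G0l n; rewrite ltNge; apply/negP => lG.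
  have [K hK] := not_lim_sup_set nN1.
  set s := debut H del tau n w in lG.
  have s0 : 0 <= s by exact: debut_ge0.
  have hit : exists t, 0 <= t /\ l <= G t w by exists s.
  have lS : l <= G (S w) w.
    apply: (@hitting_time_reached _ (G^~ w)) => [a b|t|//].
    - exact: ndG.
    - exact: rG.
  have S1 : 0 < S w.
    rewrite lt_neqAle S0 andbT; apply/eqP => S00; move: lS.
    by rewrite -S00 leNgt G0l.
  have Ss : S w <= s by exact: hitting_time_le.
  (* [k >= K] puts the point of the graph into the zero set of [H k], and [k >= n] makes [H k] count
     for [debut n]. *)
  pose k := maxn n K.
  have HS : H k (S w) w = 0.
    apply/eqP/negP => /negP HS; apply: (hK k (leq_maxr _ _)).
    by split => //; apply/DE.
  (* A time shortly before [S w]: there [H k] is at most [del k / 2] by the Lipschitz bound, so the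
     debut is at most [t < S w], against [S w <= s]. The cutoff at [0] stays below [S w] because [G]
     starts below [l]. *)
  pose t := Num.max 0 (S w - del k / 2).
  have d2 : 0 < del k / 2 by rewrite divr_gt0.
  have t0 : 0 <= t by rewrite /t le_max lexx.
  have tS : t < S w by rewrite /t gt_max S1/=; lra.
  have [_ /(_ t (S w) w) + _] := lH k; rewrite HS subr0 => HtS.
  have : H k t w < del k.
    apply: le_lt_trans (ler_norm _) (le_lt_trans HtS _).
    rewrite distrC gtr0_norm ?subr_gt0//.
    have : S w - del k / 2 <= t by rewrite /t le_max lexx orbT.
    by lra.
  move=> Htd; have : s <= t.
    apply: debut_le; split => //; apply: Or33; exists k => //; exact: leq_maxl.
  by rewrite leNgt (lt_le_trans tS).
- move=> w /not_orP[_ nN2] s E Gs.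
  have [K hK] := not_lim_sup_set nN2.
  have s0 : 0 <= s by have := tau0 w; rewrite E.
  (* Beyond [K] no alarm sounds before [tau = s], and beyond [s] the cap at time [n] does not act
     before [tau] either. *)
  exists (maxn K (Num.truncn s).+1) => n; rewrite geq_max => /andP[Kn sn].
  apply/eqP; rewrite eq_le; apply/andP; split.
    by rewrite -lee_fin -E; exact: debut_le_time.
  apply: lb_le_inf => [|t [t0 ht]]; first by exists n%:R; split => //; apply: Or31.
  case: ht => [nt|tt|[k nk Hk]].
  - apply: le_trans nt; apply: (@le_trans _ _ (Num.truncn s).+1%:R).
      by rewrite ltW// truncnS_gt.
    by rewrite ler_nat.
  - by move: tt; rewrite E lee_fin.
  - rewrite leNgt; apply/negP => ts; apply: (hK k (leq_trans Kn nk)).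
    split; first by rewrite /A/= /stopped E ltry lte_fin.
    by exists t; split => //; rewrite E lte_fin.
Unshelve. all: by end_near. Qed.

End announcing.

(** * The domination inequality *)

Section domination.
Context {d : measure_display} {T : measurableType d} {R : realType}.
Local Open Scope classical_set_scope.
Local Open Scope ring_scope.
Local Open Scope ereal_scope.
Variable P : probability T R.

(** Over an event of [A] both integrals may be computed with the conditional expectations, whose
    almost sure order then suffices. Everything is non-negative, so infinite values are allowed. *)
Lemma le_integral_cond_exp (A : set (set T)) (Y Z : T -> \bar R) (B : set T) :
  sigma_algebra setT A -> A `<=` measurable ->
  measurable_fun setT Y -> (forall w, 0 <= Y w) ->
  measurable_fun setT Z -> (forall w, 0 <= Z w) ->
  {ae P, forall w, cond_exp P A Y w <= cond_exp P A Z w} -> A B ->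
  \int[P]_(w in B) Y w <= \int[P]_(w in B) Z w.
Proof.
move=> sA AT mY Y0 mZ Z0 YZ AB.
have [mEY EY0 EY] := cond_expP P sA AT mY Y0.
have [mEZ EZ0 EZ] := cond_expP P sA AT mZ Z0.
rewrite -EY// -EZ//; apply: ae_ge0_le_integral => //.
- exact: AT.
- by apply: measurable_funTS; exact: measurable_wrt_le mEY.
- by apply: measurable_funTS; exact: measurable_wrt_le mEZ.
- by apply: filterS YZ => w h _.
Qed.

Lemma fatou_ae_le (D : set T) (x : T -> \bar R) (f : nat -> T -> \bar R) (c : \bar R) :
  measurable D -> measurable_fun setT x -> (forall w, 0 <= x w) ->
  (forall n, measurable_fun setT (f n)) -> (forall n w, 0 <= f n w) ->
  {ae P, forall w, D w -> x w <= limn_einf (f ^~ w)} ->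
  (forall n, \int[P]_(w in D) f n w <= c) -> \int[P]_(w in D) x w <= c.
Proof.
move=> mD mx x0 mf f0 xf fc.
have mli : measurable_fun D (fun w => limn_einf (f ^~ w)).
  apply: (measurableT_comp (@oppe_measurable R setT)).
  apply: (@measurable_fun_limn_esup _ _ _ _ (fun n w => - f n w)) => n.
  apply: (measurableT_comp (@oppe_measurable R setT)).
  exact: measurable_funTS.
have li0 w : 0 <= limn_einf (f ^~ w).
  rewrite limn_einf_lim; apply: lime_ge; first exact: is_cvg_einfs.
  by apply: nearW => n; apply: le_ereal_inf_tmp => _ [m _ <-].
apply: (@le_trans _ _ (\int[P]_(w in D) limn_einf (f ^~ w))).
  by apply: ae_ge0_le_integral => //; exact: measurable_funTS.
apply: le_trans.
  by apply: fatou => // n; exact: measurable_funTS.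
rewrite limn_einf_lim; apply: lime_le; first exact: is_cvg_einfs.
apply: nearW => n; apply: le_trans (fc n).
by apply: ereal_inf_lbound; exists n => /=.
Qed.

Variables (F : R -> set (set T)).
Hypothesis hF : usual_conditions P F.
Variables (X G : R -> T -> R) (tau : T -> \bar R).
Hypotheses
    (X_ge0 : nonneg_process X)
    (X_adapted : adapted F X)
    (X_rc : right_continuous_process X)
    (G_ge0 : nonneg_process G)
    (G_adapted : adapted F G)
    (G_rc : right_continuous_process G)
    (G_nd : nondecreasing_process G)
    (G_predictable : predictable F G)
    (dominated : forall sigma : T -> \bar R,
       stopping_time F sigma -> bounded_time sigma ->
       {ae P, forall w,
         (cond_exp P (F 0%R) (stopped X (cst 0%E) sigma) w
          <= cond_exp P (F 0%R) (stopped G (sup_process G) sigma) w)%E})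
    (htau : stopping_time F tau).

Let g := stopped G (sup_process G) tau.

(** Up to Fatou's lemma, the chain is [E[X_sigma; g < l] <= E[X_sigma; G_0 < l] <=
    E[G_sigma; G_0 < l] <= E[min(g, l)]] for [sigma = sigma n]. The last step holds because
    [sigma n <= tau] and, almost surely on [G_0 < l], [G] is below [l] at [sigma n]. *)
Lemma truncated_domination (l : R) : (0 < l)%R ->
  \int[P]_(w in [set w | g w < l%:E]) stopped X (cst 0) tau w
  <= \int[P]_w mine (g w) l%:E.
Proof.
move=> l0.
have [[sF FT FS] _ _] := hF.
have [tau0 _] := htau; have mtau := measurable_stopping_time hF htau.
have mX t : (0 <= t)%R -> measurable_fun setT (X t).
  by move=> t0; have := measurable_adapted hF X_adapted t0; exact.
have mG t : (0 <= t)%R -> measurable_fun setT (G t).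
  by move=> t0; have := measurable_adapted hF G_adapted t0; exact.
have msup : measurable_fun setT (sup_process G) by exact: measurable_sup_process.
have mg : measurable_fun setT g by exact: measurable_stopped.
have sup_ge t w : (0 <= t)%R -> (G t w)%:E <= sup_process G w.
  by move=> t0; apply: ereal_sup_ubound; exists t.
have g_ge t w : (0 <= t)%R -> t%:E <= tau w -> (G t w)%:E <= g w.
  rewrite /g /stopped => t0; have := tau0 w; case: (tau w) => [s| |]//=.
    by rewrite !lee_fin => s0 ts; exact: G_nd.
  by move=> _ _; exact: sup_ge.
have g0 w : 0 <= g w.
  by apply: le_trans (g_ge 0%R w (lexx _) (tau0 w)); rewrite lee_fin G_ge0.
have [sigma [N [PN [ss sn st sl slim]]]] :=
  predictable_hitting_time_announced hF l G_adapted G_rc G_nd G_predictable htau.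
have s0 n w : (0 <= sigma n w)%R by have [/(_ w)] := ss n; rewrite lee_fin.
have ms n : measurable_fun setT (sigma n).
  by apply/measurable_EFinP; exact: (measurable_stopping_time hF (ss n)).
have mgl : measurable [set w | g w < l%:E].
  by rewrite -[X in measurable X]setTI; exact: emeasurable_fun_infty_o.
have x0 w : 0 <= stopped X (cst 0) tau w.
  rewrite /stopped; have := tau0 w; case: (tau w) => [t| |]//=.
  by rewrite !lee_fin => t0; exact: X_ge0.
(* The domination can be localised only to events of [F 0]. [A0] is one of them, and it contains the
   event [g < l] because [G_0 <= g]. *)
pose A0 := [set w | (G 0 w < l)%R].
have FA0 : F 0%R A0.
  have := filtration_preimage hF G_adapted (lexx 0%R) (@measurable_itv _ `]-oo, l[).
  by congr (F _ _); apply/seteqP; split => w /=; rewrite in_itv.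
have mA0 : measurable A0 by exact: (FT _ (lexx _)).
apply: (@fatou_ae_le _ _ (fun n w => (X (sigma n w) w)%:E)) => //.
- exact: measurable_stopped.
- by move=> n; apply/measurable_EFinP; exact: measurable_right_continuous_at.
- by move=> n w; rewrite lee_fin X_ge0.
- have [N' [mN' PN' NN']] := PN; exists N'; split => // w /= h.
  apply: NN'; apply: contrapT => nN; apply: h => gl.
  (* This settles the case [tau = +oo], where [X_tau] is [0] by convention. Elsewhere [sigma n]
     equals [tau] from some index on, and the sequence is eventually constant. *)
  have pos : 0 <= limn_einf (fun n => (X (sigma n w) w)%:E).
    rewrite limn_einf_lim; apply: lime_ge; first exact: is_cvg_einfs.
    by apply: nearW => n; apply: le_ereal_inf_tmp => _ [m _ <-]; rewrite lee_fin X_ge0.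
  move: (gl); rewrite /g /stopped; have := tau0 w; case E: (tau w) => [t| |]// _.
  rewrite lte_fin => Gt; have [K hK] := slim w nN t E Gt.
  have /cvg_limn_einf_sup[-> _] : (fun n => (X (sigma n w) w)%:E) @ \oo --> (X t w)%:E.
    by apply: cvg_near_cst; exists K => // n /= Kn; rewrite hK.
  by [].
- move=> n; apply: (@le_trans _ _ (\int[P]_(w in A0) (X (sigma n w) w)%:E)).
    apply: ge0_subset_integral => //.
    + by apply: measurable_funTS; apply/measurable_EFinP; exact: measurable_right_continuous_at.
    + by move=> w _; rewrite lee_fin X_ge0.
    + by move=> w /= gl; rewrite /A0/= -lte_fin; apply: le_lt_trans gl; exact: g_ge.
  apply: (@le_trans _ _ (\int[P]_(w in A0) (G (sigma n w) w)%:E)).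
    have bs : bounded_time (EFin \o sigma n) by exists n%:R => w; rewrite lee_fin.
    apply: (@le_integral_cond_exp (F 0%R)
      (stopped X (cst 0) (EFin \o sigma n))
      (stopped G (sup_process G) (EFin \o sigma n))) => //.
    + exact: sF.
    + exact: FT.
    + by apply/measurable_EFinP; exact: measurable_right_continuous_at.
    + by move=> w; rewrite lee_fin X_ge0.
    + by apply/measurable_EFinP; exact: measurable_right_continuous_at.
    + by move=> w; rewrite lee_fin G_ge0.
    + exact: dominated.
  apply: (@le_trans _ _ (\int[P]_(w in A0) mine (g w) l%:E)).
    apply: ae_ge0_le_integral => //.
    + by move=> w _; rewrite lee_fin G_ge0.
    + by apply: measurable_funTS; apply/measurable_EFinP; exact: measurable_right_continuous_at.
    + by move=> w _; rewrite le_min g0 lee_fin ltW.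
    + by apply: measurable_funTS; apply: measurable_mine => //; exact: measurable_cst.
    + have [N' [mN' PN' NN']] := PN; exists N'; split => // w /= h.
      apply: NN'; apply: contrapT => nN; apply: h => A0w.
      by rewrite le_min g_ge//= lee_fin ltW// sl.
  apply: ge0_subset_integral => //.
  + by apply: measurable_mine => //; exact: measurable_cst.
  + by move=> w _; rewrite le_min g0 lee_fin ltW.
Qed.

End domination.

Unset Implicit Arguments.

Theorem mainTheorem3 (d : measure_display) (T : measurableType d) (R : realType)
    (P : probability T R) (F : R -> set (set T))
    (hF : usual_conditions P F)
    (X G : R -> T -> R)
    (X_ge0 : nonneg_process X)
    (X_adapted : adapted F X)
    (X_rc : right_continuous_process X)
    (G_ge0 : nonneg_process G)
    (G_adapted : adapted F G)
    (G_rc : right_continuous_process G)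
    (G_nd : nondecreasing_process G)
    (G_predictable : predictable F G)
    (dominated : forall sigma : T -> \bar R,
       stopping_time F sigma -> bounded_time sigma ->
       {ae P, forall w,
         (cond_exp P (F 0%R) (stopped X (cst 0%E) sigma) w
          <= cond_exp P (F 0%R) (stopped G (sup_process G) sigma) w)%E})
    (p : R) (hp : (0 < p < 1)%R)
    (tau : T -> \bar R) (htau : stopping_time F tau) :
  (\int[P]_w (stopped X (cst 0) tau w `^ p)
   <= (p `^ (- p))%:E * \int[P]_w (stopped G (sup_process G) tau w `^ p))%E.
Proof.
pose g := stopped G (sup_process G) tau.
have [tau0 _] := htau; have mtau := measurable_stopping_time hF htau.
have mX t : (0 <= t)%R -> measurable_fun setT (X t).
  by move=> t0; have := measurable_adapted hF X_adapted t0; exact.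
have mG t : (0 <= t)%R -> measurable_fun setT (G t).
  by move=> t0; have := measurable_adapted hF G_adapted t0; exact.
have msup : measurable_fun setT (sup_process G) by exact: measurable_sup_process.
have mg : measurable_fun setT g by exact: measurable_stopped.
(* [X_tau] is finite everywhere, thanks to the value [0] on [tau = +oo], so nothing is lost by
   [fine]. *)
pose x w := fine (stopped X (cst 0%E) tau w).
have xE w : stopped X (cst 0%E) tau w = (x w)%:E.
  by rewrite /x /stopped; have := tau0 w; case: (tau w).
under eq_integral do rewrite xE.
apply: moment_le_of_truncated => //.
- apply: (measurableT_comp (@fine_measurable R setT measurableT)).
  exact: measurable_stopped.
- move=> w; rewrite -lee_fin -xE /stopped; have := tau0 w.
  by case: (tau w) => [t| |]//=; rewrite !lee_fin => t0; exact: X_ge0.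
- move=> w; rewrite /g /stopped; have := tau0 w; case: (tau w) => [t| |]//=.
    by rewrite !lee_fin => t0; exact: G_ge0.
  move=> _; apply: le_ereal_sup_tmp; exists (G 0%R w)%:E; first by exists 0%R => /=.
  by rewrite lee_fin G_ge0.
(* [G_tau] can be infinite only where [tau] is, and there [X_tau] is [0]. *)
- move=> w; rewrite /x /g /stopped; have := tau0 w.
  by case: (tau w).
- move=> l l0; have := truncated_domination hF X_ge0 X_adapted X_rc G_ge0
    G_adapted G_rc G_nd G_predictable dominated htau l0.
  by under eq_integral do rewrite xE.
Qed.
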